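(* For integers $n\ge 1$ and $d\ge 0$, let $|\mathcal{E}_1\rangle,\dots,|\mathcal{E}_d\rangle$ be independent random vectors, each uniformly distributed on the unit sphere $\mathbb{S}^n$ of $\mathbb{C}^n$, and let $\eta_{n,d}=\max_{i\ne j}|\langle \mathcal{E}_i|\mathcal{E}_j\rangle|$. For $\varepsilon\in(0,1)$ and $s\in[0,1)$ let $$d_{max}^{\varepsilon,s}(n)=\min\{d\in\mathbb{N}\mid \mathbb{P}(\eta_{n,d}\ge\varepsilon)\ge s\}.$$ Then the following hold. 1. For every fixed $\varepsilon\in(0,1)$ and $s\in[0,1)$, $$d_{max}^{\varepsilon,s}(n)\underset{n\to\infty}{\sim}\sqrt{-2\ln(1-s)}\left(\frac{1}{1-\varepsilon^2}\right)^{\frac{n-1}{2}}.$$ 2. As $n$ or $d$ tends to infinity, $\eta_{n,d}$ converges in probability to $\sqrt{1-d^{-2/n}}$, in the following sense: for every $\delta>0$, $$\mathbb{P}\left(\left|\eta_{n,d}-\sqrt{1-d^{-2/n}}\right|\le\delta\right)\longrightarrow 1\quad\text{as }\max(n,d)\to\infty,$$ where $n\ge 1$ and $d\ge 2$.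
   Context: $\mathbb{S}^n=\{u\in\mathbb{C}^n\mid \|u\|=1\}$ denotes the unit sphere of $\mathbb{C}^n$ (a real manifold of dimension $2n-1$ inside $\mathbb{C}^n\simeq\mathbb{R}^{2n}$), and $\langle\cdot|\cdot\rangle$ is the standard Hermitian inner product on $\mathbb{C}^n$. ''Uniformly distributed'' refers to the normalized surface measure induced by Lebesgue measure on $\mathbb{R}^{2n}$. $\mathbb{N}$ contains $0$, and the maximum over an empty set of pairs (when $d\le 1$) is taken to be $0$. For sequences, $a_n\sim b_n$ means $a_n=(1+o(1))\,b_n$ as $n\to\infty$. *)

(* Defs.v *)
From HB Require Import structures.
From mathcomp Require Import all_boot all_order all_algebra.
From mathcomp Require Import all_classical all_reals all_analysis.
From mathcomp Require Export complex.

Set Implicit Arguments.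
Unset Strict Implicit.
Unset Printing Implicit Defensive.

Import Order.TTheory GRing.Theory Num.Theory.
Import numFieldNormedType.Exports.

Local Open Scope classical_set_scope.
Local Open Scope ring_scope.
Local Open Scope complex_scope.

Definition Cvec (R : realType) (n : nat) : Type := 'rV[R[i]]_n.

Section hermitian_space.
Context {R : realType} {n : nat}.

(* antilinear in the bra, linear in the ket *)
Definition braket (u v : Cvec R n) : R[i] := \sum_(k < n) (u ord0 k)^* * v ord0 k.

Definition cnorm (u : Cvec R n) : R := Num.sqrt (complex.Re (braket u u)).

Definition csphere : set (Cvec R n) := [set u | cnorm u = 1].

(* C^n ~ R^2n : (Re u_1, ..., Re u_n, Im u_1, ..., Im u_n) *)
Definition realify (u : Cvec R n) : (n + n).-tuple (measurableTypeR R) :=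
  cat_tuple (mktuple (fun k => complex.Re (u ord0 k)))
            (mktuple (fun k => complex.Im (u ord0 k))).

End hermitian_space.

(* Cvec R n carries the Borel sigma-algebra of C^n, pulled back from R^2n along
   the bijection realify. *)
HB.instance Definition _ (R : realType) (n : nat) := Choice.on (Cvec R n).
HB.instance Definition _ (R : realType) (n : nat) :=
  isPointed.Build (Cvec R n) (0 : 'rV[R[i]]_n).
HB.instance Definition _ (R : realType) (n : nat) :=
  let T := g_sigma_algebra_preimageType (@realify R n) in
  @isMeasurable.Build (preimage_display (@realify R n)) (Cvec R n)
    (g_sigma_algebra_preimage (@realify R n))
    (@measurable0 _ T) (@measurableC _ T) (@bigcupT_measurable _ T).

(* Lebesgue measure on R^m, as the iterated product of the one on R. *)
Fixpoint lebesgue_tuple (R : realType) (m : nat) :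
    set (m.-tuple (measurableTypeR R)) -> \bar R :=
  match m with
  | 0 => dirac ([tuple] : 0.-tuple (measurableTypeR R))
  | m'.+1 =>
      pushforward (product_measure1 (@lebesgue_measure R) (@lebesgue_tuple R m'))
        (fun p : measurableTypeR R * m'.-tuple (measurableTypeR R) =>
           [tuple of p.1 :: p.2])
  end.

Section uniform_sphere.
Context {R : realType} {n : nat}.

Definition lebesgue_Cvec (A : set (Cvec R n)) : \bar R :=
  lebesgue_tuple (realify @` A).

Definition cone (A : set (Cvec R n)) : set (Cvec R n) :=
  [set v | exists r u, [/\ 0 < r, r <= 1, A u & v = (r%:C *: (u : 'rV[R[i]]_n))]].

(* Surface measure of A in the sphere of R^2n, defined from Lebesgue measure by
   polar coordinates: sigma(A) = 2n * lambda({r u | 0 < r <= 1, u in A}). *)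
Definition surface (A : set (Cvec R n)) : \bar R :=
  ((2 * n)%:R%:E * lebesgue_Cvec (cone (A `&` csphere)))%E.

Definition uniform_csphere (A : set (Cvec R n)) : \bar R :=
  (surface A / surface csphere)%E.

End uniform_sphere.

Section random_vectors.
Context {R : realType} {disp : measure_display} {Omega : measurableType disp}.
Context {P : probability Omega R} {n d : nat}.

Definition mutually_independent (E : 'I_d -> {RV P >-> Cvec R n}) : Prop :=
  forall (J : {set 'I_d}) (A : 'I_d -> set (Cvec R n)),
    (forall i, measurable (A i)) ->
    P (\bigcap_(i in [set` J]) (E i @^-1` A i)) =
    (\prod_(i in J) P (E i @^-1` A i))%E.

Definition uniform_on_csphere (X : {RV P >-> Cvec R n}) : Prop :=
  forall A : set (Cvec R n), measurable A ->
    distribution P X A = uniform_csphere A.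

(* The neutral element 0 gives the value 0 when there is no pair i != j. *)
Definition eta_max (E : 'I_d -> {RV P >-> Cvec R n}) (w : Omega) : R :=
  \big[Num.max/0]_(p : 'I_d * 'I_d | p.1 != p.2)
    ComplexField.Normc.normc (braket (E p.1 w) (E p.2 w)).

End random_vectors.

(* Least element of S; the default value 0 is only used when S is empty. *)
Definition min_nat (S : set nat) : nat :=
  xget 0%N [set m | S m /\ forall k, S k -> (m <= k)%N].

Definition d_max (R : realType) (disp : nat -> measure_display)
    (Omega : forall d, measurableType (disp d))
    (P : forall d, probability (Omega d) R) (n : nat)
    (E : forall d, 'I_d -> {RV (P d) >-> Cvec R n}) (eps s : R) : nat :=
  min_nat [set d | (s%:E <= P d [set w | (eps <= eta_max (E d) w)%R])%E].

(* Main.v *)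
(* Two ideas carry the proof.
   Geometry: a translation-invariant sigma-finite measure on C^n is unique up to
   a factor, so Lebesgue measure is invariant under unitary maps and scales like
   c^(2n) under dilations. For a unit vector x the cone over the cap
   {y | eps <= |<x|y>|} may therefore be rotated to the first axis and sliced
   along C^n = C x C^(n-1). The slice over w is an annulus whose area is an
   affine function of |w|^2, and after scaling w by sqrt(1 - eps^2) it has the
   same area as the slice of the unit ball. Hence P(eps <= |<x|y>|) = p with
   p = (1 - eps^2)^(n-1).
   Probability: the events {eps <= |<E_i|E_j>|}, i < j, are pairwise independent.
   Chebyshev's inequality bounds the probability q_d that none occurs by
   4 / (d^2 p), and adding the vectors one at a time gives
   q_k (1 - k p) <= q_(k+1) <= q_k (1 - k p) + k^2 p^2, hence
   q_d = exp (- d^2 p / 2) + o(1) when d is of order p^(-1/2). *)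
Require Import Defs.
From HB Require Import structures.
From mathcomp Require Import all_boot all_order all_algebra.
From mathcomp Require Import all_classical all_reals all_analysis.
From mathcomp Require Import measurable_realfun ring lra zify.

Set Implicit Arguments.
Unset Strict Implicit.
Unset Printing Implicit Defensive.

Import Order.TTheory GRing.Theory Num.Theory.
Import numFieldNormedType.Exports.

Local Open Scope classical_set_scope.
Local Open Scope ring_scope.

(** * Lebesgue measure on tuples *)

(** Pairs of vectors may share a vector, and their overlap events are still pairwise independent
    because the conditional probability of an overlap given one of the two vectors is the same p for
    every unit vector. For each d the vectors may live on a different probability space, so q_d and
    q_(d+1) cannot be compared directly. The recursion therefore runs inside one family of d
    vectors, over the number of vectors already examined, and the minimum in [d_max] is bracketed by
    estimating q_d for every d below the threshold. For the convergence in probability, write n = m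
    + 1 and a = d^(-2/n), so that d^2 a^n = 1. With b = 1 - eps^2, the quantity d^2 p equals a^-1 (b
    / a)^m, which changes size where b crosses a, that is, where eps crosses sqrt(1 - a). A union
    bound controls the upper tail and Chebyshev's inequality the lower one. Uniformity in max(n, d)
    comes from two regimes: for large m the powers decay geometrically, and for bounded m a large d
    makes a small. *)

Lemma measurable_preimage d1 d2 (T1 : measurableType d1)
    (T2 : measurableType d2) (f : T1 -> T2) (A : set T2) :
  measurable_fun setT f -> measurable A -> measurable (f @^-1` A).
Proof. by move=> mf mA; rewrite -[X in measurable X]setTI; exact: mf. Qed.

Section push_measure.
Context d1 d2 (T1 : measurableType d1) (T2 : measurableType d2) (R : realType).
Variables (m : {measure set T1 -> \bar R}) (f : T1 -> T2).
Hypothesis mf : measurable_fun [set: T1] f.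

(* The dummy argument lets the measure structure inferred for [push mf] depend
   on the measurability proof. *)
Let push (_ : measurable_fun [set: T1] f) := pushforward m f.

Let push0 : push mf set0 = 0%E.
Proof. by rewrite /push /pushforward preimage_set0 measure0. Qed.

Let push_ge0 A : (0 <= push mf A)%E.
Proof. exact: measure_ge0. Qed.

Let push_sigma_additive : semi_sigma_additive (push mf).
Proof. exact: (@measure_semi_sigma_additive _ _ _ (pushforward m f)). Qed.

HB.instance Definition _ := isMeasure.Build _ _ _ (push mf)
  push0 push_ge0 push_sigma_additive.

Definition push_measure : {measure set T2 -> \bar R} := push mf.

Lemma push_measureE A : push_measure A = m (f @^-1` A).
Proof. by []. Qed.

End push_measure.

Section sigma_finite_bundle.
Context d (T : measurableType d) (R : realType).
Variable mu : {measure set T -> \bar R}.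
Hypothesis smu : sigma_finite setT mu.

(** The dummy argument again serves structure inference: it ties the sigma-finite structure to the
    proof [smu]. *)
Let nu (_ : sigma_finite setT mu) : set T -> \bar R := mu.

HB.instance Definition _ := Measure.copy (nu smu) mu.
HB.instance Definition _ := Measure_isSigmaFinite.Build _ _ _ (nu smu) smu.

Definition sigma_finite_bundle : {sigma_finite_measure set T -> \bar R} := nu smu.

End sigma_finite_bundle.

(** A pushforward can lose sigma-finiteness; a measurable inverse carries the exhausting sequence
    over. *)
Lemma sigma_finite_push d1 d2 (T1 : measurableType d1) (T2 : measurableType d2)
    (R : realType) (m : {measure set T1 -> \bar R}) (f : T1 -> T2) (g : T2 -> T1) :
  sigma_finite setT m -> measurable_fun setT g -> cancel f g ->
  cancel g f -> sigma_finite setT (pushforward m f).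
Proof.
move=> [F UF mF] mg fK gK; exists (fun i => g @^-1` F i).
  by rewrite -preimage_bigcup -UF preimage_setT.
move=> i; split.
  by rewrite -[X in measurable X]setTI; apply: mg => //; exact: (mF i).1.
rewrite /pushforward (_ : f @^-1` _ = F i) ?(mF i).2//.
by apply/seteqP; split => x /=; rewrite fK.
Qed.

Lemma sigma_finite_product d1 d2 (T1 : measurableType d1)
    (T2 : measurableType d2) (R : realType)
    (m1 : {sigma_finite_measure set T1 -> \bar R})
    (m2 : {sigma_finite_measure set T2 -> \bar R}) :
  sigma_finite setT (product_measure1 m1 m2).
Proof.
have /sigma_finiteP[F [FT ndF mF]] := sigma_finiteT m1.
have /sigma_finiteP[G [GT ndG mG]] := sigma_finiteT m2.
exists (fun n => F n `*` G n).
  apply/esym; rewrite -subTset => -[x y] _.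
  have [i _ Fx] : (\bigcup_i F i) x by rewrite -FT.
  have [j _ Gy] : (\bigcup_i G i) y by rewrite -GT.
  exists (maxn i j) => //; split => /=.
  - by have /subsetPset := ndF _ _ (leq_maxl i j); exact.
  - by have /subsetPset := ndG _ _ (leq_maxr i j); exact.
move=> n; have [mFn Fn] := mF n; have [mGn Gn] := mG n.
split; first exact: measurableX.
by rewrite product_measure1E// lte_mul_pinfty// ge0_fin_numE.
Qed.

Section lebesgue_tuple_measure.
Context (R : realType).
Local Notation mR := (measurableTypeR R).

Definition tcons m (p : mR * m.-tuple mR) : m.+1.-tuple mR := [tuple of p.1 :: p.2].
Definition tuncons m (t : m.+1.-tuple mR) : mR * m.-tuple mR :=
  (thead t, [tuple of behead t]).

Lemma tconsK m : cancel (@tcons m) (@tuncons m).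
Proof. by move=> [x t]; congr pair; apply/val_inj. Qed.

Lemma tunconsK m : cancel (@tuncons m) (@tcons m).
Proof. by move=> t; rewrite [RHS]tuple_eta. Qed.

Lemma measurable_tcons m : measurable_fun setT (@tcons m).
Proof. exact: measurable_cons. Qed.

Lemma measurable_tuncons m : measurable_fun setT (@tuncons m).
Proof.
apply/measurable_fun_pairP; split; last exact: measurable_behead.
exact: (measurable_tnth ord0).
Qed.

(** [lebesgue_tuple] is a bare set function. Rewriting with this equation gives access to the theory
    of sigma-finite measures. *)
Lemma lebesgue_tuple_measure m :
  exists mu : {sigma_finite_measure set (m.-tuple mR) -> \bar R},
    mu = @lebesgue_tuple R m :> (set _ -> \bar R).
Proof.
elim: m => [|m [mu muE]].
  by exists (dirac ([tuple] : 0.-tuple mR)).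
have sf : sigma_finite setT
    (push_measure (product_measure1 (@lebesgue_measure R) mu) (@measurable_tcons m)).
  apply: (@sigma_finite_push _ _ _ _ _ _ (@tcons m) (@tuncons m)).
  - exact: sigma_finite_product.
  - exact: measurable_tuncons.
  - exact: tconsK.
  - exact: tunconsK.
by exists (sigma_finite_bundle sf); rewrite /= -muE.
Qed.

Lemma lebesgue_measureD (a : R) (A : set mR) : measurable A ->
  lebesgue_measure ((fun x : mR => (x + a : mR)) @^-1` A) = lebesgue_measure A.
Proof.
move=> mA; have mf : measurable_fun setT (fun x : mR => (x + a : mR)).
  by apply: measurable_funD => //; exact: measurable_cst.
rewrite -[LHS]/(push_measure lebesgue_measure mf A).
apply/esym; apply: lebesgue_measure_unique mA.
move=> _ [[u v]] _ <-; rewrite push_measureE /=.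
have -> : (fun x : mR => (x + a : mR)) @^-1` `]u, v]%classic =
    `](u - a), (v - a)]%classic :> set mR.
  by apply/seteqP; split => x; rewrite /= !in_itv /= ltrBlDr lerBrDr.
rewrite !lebesgue_measure_itv /= !lte_fin ltrD2r.
by case: ifP => // _; rewrite -!EFinB; congr EFin; rewrite opprB addrA subrK.
Qed.

Definition tshift m (a t : m.-tuple mR) : m.-tuple mR :=
  [tuple tnth t i + tnth a i | i < m].

Lemma measurable_tshift m (a : m.-tuple mR) : measurable_fun setT (tshift a).
Proof.
apply/measurable_fun_tnthP => i.
rewrite (_ : _ \o _ = fun t => tnth t i + tnth a i); last first.
  by apply/funext => t /=; rewrite tnth_mktuple.
by apply: measurable_funD => //; exact: measurable_tnth.
Qed.

(** Translating the head and the tail separately preserves the measure of rectangles, and these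
    determine a product measure. *)
Lemma lebesgue_tupleD m (a : m.-tuple mR) (A : set (m.-tuple mR)) :
  measurable A -> lebesgue_tuple (tshift a @^-1` A) = lebesgue_tuple A.
Proof.
elim: m a A => [|m IH] a A mA.
  rewrite (_ : tshift a @^-1` A = A)//; apply/seteqP.
  by split => t /=; rewrite (tuple0 (tshift a t)) (tuple0 t).
have [mu muE] := lebesgue_tuple_measure m.
pose a' : m.-tuple mR := [tuple of behead a].
pose sh (p : mR * m.-tuple mR) := ((p.1 + thead a : mR), tshift a' p.2).
have msh : measurable_fun setT sh.
  apply/measurable_fun_pairP; split.
    by apply: measurable_funD => //; exact: measurable_cst.
  by apply: (measurableT_comp (measurable_tshift a')).
have tconsD : tshift a \o @tcons m = @tcons m \o sh.
  apply/funext => -[x t] /=; apply/eq_from_tnth => i; rewrite tnth_mktuple.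
  case: (unliftP ord0 i) => [j ->|->]; rewrite /tcons /= ?tnth0//.
  by rewrite !tnthS tnth_mktuple tnth_behead; congr (_ + tnth _ _); apply/val_inj; rewrite /= inordK //; exact: ltn_ord.
have mA' : measurable (@tcons m @^-1` A).
  exact: measurable_preimage (@measurable_tcons m) mA.
rewrite /= -muE /pushforward.
rewrite -[LHS]/(product_measure1 lebesgue_measure mu ((tshift a \o @tcons m) @^-1` A)).
rewrite tconsD -[LHS]/(push_measure (product_measure1 (@lebesgue_measure R) mu)
  msh (@tcons m @^-1` A)).
apply/esym; apply: product_measure_unique mA' => B C mB mC.
rewrite push_measureE; transitivity
  (lebesgue_measure ((fun x : mR => (x + thead a : mR)%R) @^-1` B) * mu C)%E; last first.
  by rewrite lebesgue_measureD.
rewrite (_ : mu C = mu (tshift a' @^-1` C)); last by rewrite muE IH.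
rewrite -product_measure1E//.
- rewrite -[X in measurable X]setTI; apply: measurable_funD => //; exact: measurable_cst.
- exact: measurable_preimage (measurable_tshift a') mC.
Qed.

(** Centred cubes are the test sets whose explicit volume fixes every proportionality factor
    below. *)
Definition tbox m (a : R) : set (m.-tuple mR) :=
  [set t | forall i, `|tnth t i| <= a].
Arguments tbox : clear implicits.

Lemma tbox_tcons m a :
  @tcons m @^-1` tbox m.+1 a = `[- a, a]%classic `*` tbox m a.
Proof.
apply/seteqP; split => -[x t] /=.
  move=> H; split; first by rewrite /= in_itv /= -ler_norml; exact: H ord0.
  by move=> i; have := H (lift ord0 i); rewrite /tcons tnthS.
rewrite /= in_itv /= -ler_norml => -[xa ta] i.
by case: (unliftP ord0 i) => [j ->|->]; rewrite /tcons /= ?tnthS.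
Qed.

Lemma measurable_tbox m a : measurable (tbox m a).
Proof.
elim: m => [|m IH].
  by rewrite (_ : tbox 0 a = setT)//; apply/seteqP; split => // t _ [].
rewrite (_ : tbox _ _ = @tuncons m @^-1` (`[- a, a]%classic `*` tbox m a)).
  rewrite -[X in measurable X]setTI; apply: measurable_tuncons => //.
  exact: measurableX.
by rewrite -tbox_tcons -comp_preimage; apply/seteqP; split => t /=; rewrite tunconsK.
Qed.

Lemma lebesgue_tuple_tbox m a : 0 <= a ->
  lebesgue_tuple (tbox m a) = ((2 * a) ^+ m)%:E.
Proof.
move=> a0; elim: m => [|m IH]; first by rewrite /= diracE mem_set//; case.
have [mu muE] := lebesgue_tuple_measure m.
rewrite /= -muE /pushforward.
rewrite -[LHS]/(product_measure1 lebesgue_measure mu (@tcons m @^-1` tbox m.+1 a)).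
rewrite tbox_tcons product_measure1E//; last exact: measurable_tbox.
rewrite muE IH [X in (X * _)%E]lebesgue_measure_itv /= lte_fin exprS EFinM.
case: ltP => [_|a0']; first by congr (_ * _)%E; rewrite -EFinB; congr EFin; rewrite opprK mulr_natl.
have -> : a = 0 by apply/eqP; rewrite eq_le a0 andbT -oppr_ge0 (le_trans a0).
by rewrite mulr0.
Qed.

End lebesgue_tuple_measure.
Arguments tbox {R} m a.

(** * Lebesgue measure on complex vectors *)

Section Cvec_measure.
Context (R : realType) (n : nat).
Local Notation mR := (measurableTypeR R).
Implicit Types u v : Cvec R n.

Definition re_coord (k : 'I_n) u : mR := complex.Re (u ord0 k).
Definition im_coord (k : 'I_n) u : mR := complex.Im (u ord0 k).

Lemma tnth_realify_l u k : tnth (realify u) (lshift n k) = re_coord k u.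
Proof. by rewrite tnth_lshift tnth_mktuple. Qed.

Lemma tnth_realify_r u k : tnth (realify u) (rshift n k) = im_coord k u.
Proof. by rewrite tnth_rshift tnth_mktuple. Qed.

Definition unrealify (t : (n + n).-tuple mR) : Cvec R n :=
  \row_k (tnth t (lshift n k) +i* tnth t (rshift n k))%C.

Lemma realifyK : cancel (@realify R n) unrealify.
Proof.
move=> u; apply/rowP => k; rewrite mxE tnth_realify_l tnth_realify_r.
by rewrite /re_coord /im_coord; case: (u ord0 k).
Qed.

Lemma unrealifyK : cancel unrealify (@realify R n).
Proof.
move=> t; apply/eq_from_tnth => i;
case: (split_ordP i) => k ->; rewrite ?tnth_realify_l ?tnth_realify_r.
  by rewrite /re_coord mxE.
by rewrite /im_coord mxE.
Qed.

Lemma measurable_realify : measurable_fun setT (@realify R n).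
Proof. by move=> _ B mB; rewrite setTI; exists B => //; rewrite setTI. Qed.

Lemma measurable_CvecP d (T : measurableType d) (f : T -> Cvec R n) :
  measurable_fun setT f <-> (forall k, measurable_fun setT (re_coord k \o f)) /\
                            (forall k, measurable_fun setT (im_coord k \o f)).
Proof.
transitivity (measurable_fun setT (@realify R n \o f)).
  split=> [mf|mf]; first exact: measurableT_comp measurable_realify mf.
  move=> _ A [B mB <-]; rewrite !setTI.
  by have := mf measurableT B mB; rewrite setTI.
split=> [/measurable_fun_tnthP H|[Hr Hi]].
  split=> k.
    by have := H (lshift n k); congr measurable_fun; apply/funext => x /=; rewrite tnth_realify_l.
  by have := H (rshift n k); congr measurable_fun; apply/funext => x /=; rewrite tnth_realify_r.
apply/measurable_fun_tnthP => i;
case: (split_ordP i) => k ->.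
  by have := Hr k; congr measurable_fun; apply/funext => x /=; rewrite tnth_realify_l.
by have := Hi k; congr measurable_fun; apply/funext => x /=; rewrite tnth_realify_r.
Qed.

Lemma measurable_re_coord k : measurable_fun setT (re_coord k).
Proof. by have [+ _] := (measurable_CvecP (@id (Cvec R n))).1 (@measurable_id _ _ setT); apply. Qed.

Lemma measurable_im_coord k : measurable_fun setT (im_coord k).
Proof. by have [_ +] := (measurable_CvecP (@id (Cvec R n))).1 (@measurable_id _ _ setT); apply. Qed.

Lemma measurable_unrealify : measurable_fun setT unrealify.
Proof.
apply/measurable_CvecP; split=> k.
  have := @measurable_tnth _ mR (n + n) (lshift n k); congr measurable_fun.
  by apply/funext => t /=; rewrite /re_coord mxE.
have := @measurable_tnth _ mR (n + n) (rshift n k); congr measurable_fun.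
by apply/funext => t /=; rewrite /im_coord mxE.
Qed.

Lemma lebesgue_CvecE (A : set (Cvec R n)) :
  lebesgue_Cvec A = lebesgue_tuple (unrealify @^-1` A).
Proof.
congr lebesgue_tuple; apply/seteqP; split=> t /=.
  by move=> [u Au <-]; rewrite realifyK.
by move=> At; exists (unrealify t) => //; exact: unrealifyK.
Qed.

Lemma lebesgue_Cvec_measure :
  exists mu : {sigma_finite_measure set (Cvec R n) -> \bar R},
    mu = @lebesgue_Cvec R n :> (set _ -> \bar R).
Proof.
have [mu muE] := lebesgue_tuple_measure R (n + n).
have sf : sigma_finite setT (push_measure mu measurable_unrealify).
  apply: (@sigma_finite_push _ _ _ _ _ _ unrealify (@realify R n)).
  - exact: sigma_finiteT.
  - exact: measurable_realify.
  - exact: unrealifyK.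
  - exact: realifyK.
exists (sigma_finite_bundle sf); apply/funext => A.
by rewrite lebesgue_CvecE -muE.
Qed.

Definition translation_invariant (mu : set (Cvec R n) -> \bar R) :=
  forall (v : 'rV[R[i]]_n) A, measurable A ->
    mu ((fun u : Cvec R n => ((u : 'rV_n) + v : Cvec R n)) @^-1` A) = mu A.

Lemma lebesgue_CvecD : translation_invariant (@lebesgue_Cvec R n).
Proof.
move=> v A mA; rewrite !lebesgue_CvecE.
rewrite -[RHS](lebesgue_tupleD (realify (v : Cvec R n))); last first.
  exact: measurable_preimage measurable_unrealify mA.
congr lebesgue_tuple; apply/seteqP.
suff E t : ((unrealify t : 'rV_n) + v) = unrealify (tshift (realify (v : Cvec R n)) t).
  by split => t /=; rewrite E.
apply/rowP => k; rewrite !mxE !tnth_mktuple tnth_realify_l tnth_realify_r.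
by rewrite /re_coord /im_coord; case: (v ord0 k).
Qed.

Definition cube (a : R) : set (Cvec R n) :=
  [set u | forall k, `|re_coord k u| <= a /\ `|im_coord k u| <= a].

Lemma cubeE a : cube a = @realify R n @^-1` tbox (n + n) a.
Proof.
apply/seteqP; split => u /= H.
  move=> i; case: (split_ordP i) => k ->; have [Hr Hi] := H k.
    by rewrite tnth_realify_l.
  by rewrite tnth_realify_r.
move=> k; split.
  by have := H (lshift n k); rewrite tnth_realify_l.
by have := H (rshift n k); rewrite tnth_realify_r.
Qed.

Lemma measurable_cube a : measurable (cube a).
Proof.
rewrite cubeE -[X in measurable X]setTI.
by apply: measurable_realify => //; exact: measurable_tbox.
Qed.

Lemma lebesgue_Cvec_cube a : 0 <= a ->
  lebesgue_Cvec (cube a) = ((2 * a) ^+ (n + n))%:E.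
Proof.
move=> a0; rewrite lebesgue_CvecE cubeE -lebesgue_tuple_tbox//.
by congr lebesgue_tuple; apply/seteqP; split => t /=; rewrite unrealifyK.
Qed.

End Cvec_measure.
Arguments cube {R n} a.

(** * Uniqueness of translation-invariant measures *)

(** Tonelli for a set with sections of constant measure over [A] and null sections elsewhere. It
    serves both the uniqueness of invariant measures and the conditioning on one random vector. *)
Lemma product_measure1_cst d1 d2 (T1 : measurableType d1)
    (T2 : measurableType d2) (R : realType) (m1 : {measure set T1 -> \bar R})
    (m2 : {measure set T2 -> \bar R}) (D : set (T1 * T2)) (A : set T1) c :
  measurable A -> (0 <= c)%E ->
  (forall x, A x -> m2 (xsection D x) = c) ->
  (forall x, ~ A x -> m2 (xsection D x) = 0%E) ->
  product_measure1 m1 m2 D = (m1 A * c)%E.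
Proof.
move=> mA c0 cA cN; rewrite /product_measure1.
rewrite (eq_integral (fun x => (\1_A x)%:E * c)%E); last first.
  move=> x _ /=; rewrite indicE; case: (boolP (x \in A)) => xA.
    by rewrite mul1e cA//; move: xA; rewrite inE.
  by rewrite mul0e cN// => Ax; move/negP: xA; apply; rewrite inE.
rewrite ge0_integralZr//; last by apply/measurable_EFinP; exact: measurable_indic.
by rewrite integral_indic// setIT.
Qed.

Lemma product_measure1E2 d1 d2 (T1 : measurableType d1)
    (T2 : measurableType d2) (R : realType)
    (m1 : {sigma_finite_measure set T1 -> \bar R})
    (m2 : {sigma_finite_measure set T2 -> \bar R}) (D : set (T1 * T2)) :
  measurable D -> product_measure1 m1 m2 D = (\int[m2]_y m1 (ysection D y))%E.
Proof.
move=> mD; rewrite -[RHS]/(product_measure2 m1 m2 D).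
by apply: product_measure_unique => // A B mA mB; exact: product_measure2E.
Qed.

Lemma mule_cancelr (R : realType) (a b c : \bar R) :
  (0 < c)%E -> (c < +oo)%E -> (a * c = b * c)%E -> a = b.
Proof.
case: c => [c||] // c0 _ H.
have cn0 : c != 0 by rewrite gt_eqF// -lte_fin.
have K (x : \bar R) : (x * c%:E * (c^-1)%:E = x)%E by rewrite -muleA -EFinM divff// mule1.
by rewrite -[a]K H K.
Qed.

Section haar.
Context (R : realType) (n : nat).
Local Notation V := (Cvec R n).

Definition vadd (u v : V) : V := (u : 'rV_n) + (v : 'rV_n).
Definition vsub (u v : V) : V := (u : 'rV_n) - (v : 'rV_n).

Lemma measurable_vadd : measurable_fun setT (fun p : V * V => vadd p.1 p.2).
Proof.
apply/measurable_CvecP; split => k.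
  rewrite (_ : _ \o _ = fun p => re_coord k p.1 + re_coord k p.2); last first.
    by apply/funext => -[u v]; rewrite /re_coord /= mxE raddfD.
  by apply: measurable_funD; apply: (measurableT_comp (measurable_re_coord k)).
rewrite (_ : _ \o _ = fun p => im_coord k p.1 + im_coord k p.2); last first.
  by apply/funext => -[u v]; rewrite /im_coord /= mxE raddfD.
by apply: measurable_funD; apply: (measurableT_comp (measurable_im_coord k)).
Qed.

Lemma measurable_vsub : measurable_fun setT (fun p : V * V => vsub p.1 p.2).
Proof.
apply/measurable_CvecP; split => k.
  rewrite (_ : _ \o _ = fun p => re_coord k p.1 - re_coord k p.2); last first.
    by apply/funext => -[u v]; rewrite /re_coord /= !mxE raddfB.
  by apply: measurable_funB; apply: (measurableT_comp (measurable_re_coord k)).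
rewrite (_ : _ \o _ = fun p => im_coord k p.1 - im_coord k p.2); last first.
  by apply/funext => -[u v]; rewrite /im_coord /= !mxE raddfB.
by apply: measurable_funB; apply: (measurableT_comp (measurable_im_coord k)).
Qed.

Definition vneg (u : V) : V := - (u : 'rV_n).

Lemma measurable_vneg : measurable_fun setT vneg.
Proof.
rewrite (_ : vneg = (fun p : V * V => vsub p.1 p.2) \o (fun u : V => ((0 : 'rV_n) : V, u))).
  apply: measurableT_comp; first exact: measurable_vsub.
  by apply: measurable_fun_pair => //; exact: measurable_cst.
by apply/funext => u; rewrite /vneg /vsub /= sub0r.
Qed.

(* The sets {(x, y) | x \in A, x + y \in B} and {(x, y) | x \in B, x - y \in A}
   have the same sections over y up to a translation. *)
Lemma haar_exchange (mu nu : {sigma_finite_measure set V -> \bar R})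
    (A B : set V) :
  translation_invariant mu -> translation_invariant nu ->
  measurable A -> measurable B ->
  (mu A * nu B = mu B * nu (vneg @^-1` A))%E.
Proof.
move=> tmu tnu mA mB.
pose D : set (V * V) := (fst @^-1` A) `&` ((fun p => vadd p.1 p.2) @^-1` B).
pose D' : set (V * V) := (fst @^-1` B) `&` ((fun p => vsub p.1 p.2) @^-1` A).
have mD : measurable D.
  by apply: measurableI; apply: measurable_preimage => //; exact: measurable_vadd.
have mD' : measurable D'.
  by apply: measurableI; apply: measurable_preimage => //; exact: measurable_vsub.
have mN : measurable (vneg @^-1` A).
  by apply: measurable_preimage => //; exact: measurable_vneg.
transitivity (product_measure1 mu nu D).
  apply/esym/product_measure1_cst => // x xA.
    rewrite -(tnu x B)//; congr (nu _); apply/seteqP; split => y;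
      rewrite /xsection /= inE /D /= /vadd addrC => H; [by case: H|by split].
  by rewrite (_ : xsection _ _ = set0) ?measure0//; apply/seteqP; split => y;
    rewrite /xsection /= inE /D //= => -[].
transitivity (product_measure1 mu nu D'); last first.
  apply: product_measure1_cst => // x xA.
    rewrite -(tnu (- (x : 'rV_n)) _ mN); congr (nu _); apply/seteqP; split => y;
      rewrite /xsection /= inE /D' /= /vsub /vneg opprB => H; [by case: H|by split].
  by rewrite (_ : xsection _ _ = set0) ?measure0//; apply/seteqP; split => y;
    rewrite /xsection /= inE /D' //= => -[].
rewrite !product_measure1E2//; apply: eq_integral => y _.
rewrite -(tmu (- (y : 'rV_n)) (ysection D y)); last exact: measurable_ysection.
congr (mu _); apply/seteqP; split => x; rewrite /ysection /= !inE /D /D' /= /vadd /vsub.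
  by rewrite subrK => -[].
by rewrite subrK => -[].
Qed.

(** The exchange identity leaves [nu] evaluated at the reflection of [A]. The same identity with
    [mu] replaced by [nu], tested on [C], shows that [nu] is invariant under reflection. *)
Lemma haar_unique (mu nu : {sigma_finite_measure set V -> \bar R})
    (A B C : set V) :
  translation_invariant mu -> translation_invariant nu ->
  measurable A -> measurable B -> measurable C ->
  (0 < nu C)%E -> (nu C < +oo)%E ->
  (mu A * nu B = mu B * nu A)%E.
Proof.
move=> tmu tnu mA mB mC C0 Coo.
rewrite (haar_exchange tmu tnu mA mB); congr (_ * _)%E.
have := haar_exchange tnu tnu mA mC.
by rewrite [RHS]muleC => /(mule_cancelr C0 Coo).
Qed.

Definition sqnorm (u : V) : R := \sum_k (re_coord k u ^+ 2 + im_coord k u ^+ 2).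

Lemma sqnorm_ge0 u : 0 <= sqnorm u.
Proof. by apply: sumr_ge0 => k _; rewrite addr_ge0// sqr_ge0. Qed.

Lemma sqnormE u : complex.Re (braket u u) = sqnorm u.
Proof.
rewrite /braket /sqnorm raddf_sum; apply: eq_bigr => k _.
rewrite /re_coord /im_coord; case: (u ord0 k) => a b /=.
by rewrite mulNr opprK.
Qed.

Lemma cnormE u : cnorm u = Num.sqrt (sqnorm u).
Proof. by rewrite /cnorm sqnormE. Qed.

Lemma measurable_sqnorm : measurable_fun setT sqnorm.
Proof.
apply: measurable_sum => k; apply: measurable_funD; apply: measurable_funX.
  exact: measurable_re_coord.
exact: measurable_im_coord.
Qed.

Definition cball : set V := [set u | sqnorm u <= 1].

Lemma measurable_sqnorm_le r : measurable [set u : V | sqnorm u <= r].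
Proof.
rewrite (_ : [set _ | _] = sqnorm @^-1` `]-oo, r]%classic).
  exact: (measurable_preimage measurable_sqnorm).
by apply/seteqP; split => u /=; rewrite in_itv.
Qed.

Lemma coord_sqr_le_sqnorm u k :
  re_coord k u ^+ 2 <= sqnorm u /\ im_coord k u ^+ 2 <= sqnorm u.
Proof.
rewrite /sqnorm (bigD1 k)//=.
have H : 0 <= \sum_(i < n | i != k) (re_coord i u ^+ 2 + im_coord i u ^+ 2).
  by apply: sumr_ge0 => i _; rewrite addr_ge0// sqr_ge0.
have := sqr_ge0 (re_coord k u); have := sqr_ge0 (im_coord k u).
by split; lra.
Qed.

Lemma cball_sub_cube : cball `<=` cube 1.
Proof.
move=> u u1 k; have [H1 H2] := coord_sqr_le_sqnorm u k.
have sq1 (x : R) : x ^+ 2 <= 1 -> `|x| <= 1.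
  by move=> x1; rewrite -(@expr_le1 _ 2)// real_normK ?num_real.
by split; apply: sq1; [exact: le_trans H1 _|exact: le_trans H2 _].
Qed.

(** A vector has 2n real coordinates, and 2n [a0]^2 <= 1; the successor keeps the inverse meaningful
    when n = 0. *)
Let a0 : R := (n.*2.+1)%:R^-1.

Lemma cube_sub_cball : cube a0 `<=` cball.
Proof.
move=> u H.
have a0_ge0 : 0 <= a0 by rewrite invr_ge0.
have sq x : `|x| <= a0 -> x ^+ 2 <= a0 ^+ 2 by move=> xa; rewrite -[leLHS]real_normK ?num_real// ler_sqr ?nnegrE.
rewrite /cball /sqnorm /=.
apply: (@le_trans _ _ (\sum_(k < n) (a0 ^+ 2 + a0 ^+ 2))).
  by apply: ler_sum => k _; have [/sq H1 /sq H2] := H k; rewrite lerD.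
rewrite sumr_const card_ord -mulr2n -mulrnA mul2n -mulr_natl.
rewrite expr2 mulrA; apply: mulr_ile1 => //.
- by rewrite mulr_ge0.
- by rewrite /a0 ler_pdivrMr// mul1r ler_nat.
- by rewrite invf_le1// ler1n.
Qed.

Lemma lebesgue_Cvec_cball :
  (0 < @lebesgue_Cvec R n cball)%E /\ (@lebesgue_Cvec R n cball < +oo)%E.
Proof.
have [mu muE] := lebesgue_Cvec_measure R n; rewrite -muE.
have mcb : measurable cball by exact: measurable_sqnorm_le.
split.
  apply: (@lt_le_trans _ _ (mu (cube a0))); last first.
    by apply: le_measure; rewrite ?inE//; [exact: measurable_cube|exact: cube_sub_cball].
  by rewrite muE lebesgue_Cvec_cube ?invr_ge0// lte_fin exprn_gt0// mulr_gt0// invr_gt0.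
apply: (@le_lt_trans _ _ (mu (cube 1))).
  by apply: le_measure; rewrite ?inE//; [exact: measurable_cube|exact: cball_sub_cube].
by rewrite muE lebesgue_Cvec_cube// ltry.
Qed.

Lemma haar_lebesgue (mu : {measure set V -> \bar R}) (A B : set V) :
  sigma_finite setT mu -> translation_invariant mu ->
  measurable A -> measurable B ->
  (mu A * lebesgue_Cvec B = mu B * lebesgue_Cvec A)%E.
Proof.
move=> smu tmu mA mB.
have [nu nuE] := lebesgue_Cvec_measure R n; rewrite -nuE.
have [c0 coo] := lebesgue_Cvec_cball.
apply: (@haar_unique (sigma_finite_bundle smu) nu A B cball) => //.
- by rewrite nuE; exact: lebesgue_CvecD.
- exact: measurable_sqnorm_le.
- by rewrite nuE.
- by rewrite nuE.
Qed.

(** Additivity of [f] makes the pushforward of Lebesgue measure translation invariant, hence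
    proportional to Lebesgue measure. The cross-multiplied form lets a convenient test set [B]
    reveal the factor without a determinant. *)
Lemma lebesgue_Cvec_linear (f g : V -> V) (A B : set V) :
  measurable_fun setT f -> measurable_fun setT g -> cancel f g -> cancel g f ->
  (forall u v, f (vadd u v) = vadd (f u) (f v)) ->
  measurable A -> measurable B ->
  (lebesgue_Cvec (f @^-1` A) * lebesgue_Cvec B =
   lebesgue_Cvec (f @^-1` B) * lebesgue_Cvec A)%E.
Proof.
move=> mf mg fK gK fD mA mB.
have [nu nuE] := lebesgue_Cvec_measure R n; rewrite -{1 3}nuE.
apply: (@haar_lebesgue (push_measure nu mf)) => //.
  by apply: (@sigma_finite_push _ _ _ _ _ nu f g) => //; exact: sigma_finiteT.
move=> v C mC; rewrite !push_measureE.
have mfC : measurable (f @^-1` C) by exact: measurable_preimage.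
rewrite -[LHS]/(nu _) -[RHS]/(nu _) nuE -[RHS](lebesgue_CvecD (g v) mfC); congr lebesgue_Cvec.
by apply/seteqP; split => u /=; rewrite -/(vadd u (g v)) fD gK.
Qed.

End haar.

(** * Dilations and matrix maps *)

Section linear_maps.
Context (R : realType) (n : nat).
Local Notation V := (Cvec R n).
Local Notation leb := (@lebesgue_Cvec R n).

Definition vscale (c : R) (u : V) : V := (c%:C)%C *: (u : 'rV_n).

Lemma re_vscale c k u : re_coord k (vscale c u) = c * re_coord k u.
Proof. by rewrite /re_coord mxE; case: (u _ _) => a b /=; rewrite mul0r subr0. Qed.

Lemma im_vscale c k u : im_coord k (vscale c u) = c * im_coord k u.
Proof. by rewrite /im_coord mxE; case: (u _ _) => a b /=; rewrite mul0r addr0. Qed.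

Lemma sqnorm_vscale c u : sqnorm (vscale c u) = c ^+ 2 * sqnorm u.
Proof.
rewrite /sqnorm mulr_sumr; apply: eq_bigr => k _.
by rewrite re_vscale im_vscale !exprMn mulrDr.
Qed.

Lemma measurable_vscale c : measurable_fun setT (vscale c).
Proof.
apply/measurable_CvecP; split => k.
  rewrite (_ : _ \o _ = fun u => c * re_coord k u).
    apply: measurable_funM; first exact: measurable_cst.
    exact: measurable_re_coord.
  by apply/funext => u /=; rewrite re_vscale.
rewrite (_ : _ \o _ = fun u => c * im_coord k u).
  apply: measurable_funM; first exact: measurable_cst.
  exact: measurable_im_coord.
by apply/funext => u /=; rewrite im_vscale.
Qed.

Lemma vscaleK c : c != 0 -> cancel (vscale c) (vscale c^-1).
Proof. by move=> c0 u; rewrite /vscale scalerA -rmorphM /= mulVf// scale1r. Qed.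

Lemma lebesgue_Cvec_scale c A : 0 < c -> measurable A ->
  leb (vscale c @^-1` A) = ((c^-1 ^+ (n + n))%:E * leb A)%E.
Proof.
move=> c0 mA; have cn0 : c != 0 by rewrite gt_eqF.
have c1 : leb (cube 1) = (2 ^+ (n + n))%:E by rewrite lebesgue_Cvec_cube// mulr1.
apply: (@mule_cancelr _ _ _ (leb (cube 1))).
- by rewrite c1 lte_fin exprn_gt0.
- by rewrite c1 ltry.
rewrite (@lebesgue_Cvec_linear _ _ (vscale c) (vscale c^-1) A (cube 1))//.
(* The unit cube is the test set: its preimage is again a cube, of known volume. *)
- rewrite (_ : vscale c @^-1` cube 1 = cube c^-1).
    rewrite lebesgue_Cvec_cube ?invr_ge0 ?ltW// c1.
    by rewrite exprMn EFinM -muleA muleC -muleA; congr (_ * _)%E; rewrite muleC.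
  have cc (x : R) : (`|c * x| <= 1) = (`|x| <= c^-1).
    by rewrite normrM gtr0_norm// -ler_pdivlMl// mulr1.
  by apply/seteqP; split => u /= H k; have := H k; rewrite re_vscale im_vscale !cc.
- exact: measurable_vscale.
- exact: measurable_vscale.
- exact: vscaleK.
- by rewrite -{2}[c]invrK; apply: vscaleK; rewrite invr_eq0.
- by move=> u v; rewrite /vscale /vadd scalerDr.
- exact: measurable_cube.
Qed.

(** The origin is fixed by doubling, yet its measure is multiplied by 2^(-2n) < 1; being finite, the
    measure vanishes. *)
Lemma lebesgue_Cvec_point : (0 < n)%N -> leb [set u | sqnorm u <= 0] = 0%E.
Proof.
move=> n0; set Z := [set _ | _].
have mZ : measurable Z by exact: measurable_sqnorm_le.
have H : leb Z = ((2^-1 ^+ (n + n))%:E * leb Z)%E.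
  rewrite -lebesgue_Cvec_scale//; congr leb; apply/seteqP.
  by split => u; rewrite /Z /= sqnorm_vscale pmulr_rle0// exprn_gt0.
have [mu muE] := lebesgue_Cvec_measure R n.
have Zoo : (leb Z < +oo)%E.
  have [_] := lebesgue_Cvec_cball R n; apply: le_lt_trans.
  rewrite -muE; apply: le_measure; rewrite ?inE//; first exact: measurable_sqnorm_le.
  by move=> u /= u0; rewrite /cball /= (le_trans u0).
have Z0 : (0 <= leb Z)%E by rewrite -muE.
move: H Zoo Z0; case: (leb Z) => // z [/eqP].
rewrite -subr_eq0 -{1}[z]mul1r -mulrBl mulf_eq0 => /orP[|/eqP->//].
rewrite subr_eq0 eq_sym => /eqP H; exfalso.
have : (2^-1 ^+ (n + n) : R) < 1 by rewrite exprn_ilt1 ?invr_ge0 ?invf_lt1 ?ltr1n// addn_eq0 andbb -lt0n.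
by rewrite H ltxx.
Qed.

Lemma measurable_mulmx (U : 'M[R[i]]_n) :
  measurable_fun setT (fun u : V => ((u : 'rV_n) *m U : V)).
Proof.
apply/measurable_CvecP; split => k.
  rewrite (_ : _ \o _ = fun u => \sum_j (re_coord j u * complex.Re (U j k) - im_coord j u * complex.Im (U j k))).
    apply: measurable_sum => j; apply: measurable_funB; apply: measurable_funM; try exact: measurable_cst.
      exact: measurable_re_coord.
    exact: measurable_im_coord.
  apply/funext => u /=; rewrite /re_coord /im_coord mxE raddf_sum /=.
  by apply: eq_bigr => j _; case: (u _ _) => a b; case: (U _ _).
rewrite (_ : _ \o _ = fun u => \sum_j (re_coord j u * complex.Im (U j k) + im_coord j u * complex.Re (U j k))).
  apply: measurable_sum => j; apply: measurable_funD; apply: measurable_funM; try exact: measurable_cst.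
    exact: measurable_re_coord.
  exact: measurable_im_coord.
apply/funext => u /=; rewrite /re_coord /im_coord mxE raddf_sum /=.
by apply: eq_bigr => j _; case: (u _ _) => a b; case: (U _ _).
Qed.

End linear_maps.

(** * Areas of discs in the complex plane *)

Section disc.
Context (R : realType).
Local Notation leb := (@lebesgue_Cvec R 1).
Local Notation K := (leb (@cball R 1)).

(** Here [r] is the squared radius, so the area is linear in it. The area [K] of the unit disc stays
    symbolic, since it cancels in the end. *)
Lemma area_disc (r : R) : 0 <= r -> leb [set u | sqnorm u <= r] = (r%:E * K)%E.
Proof.
rewrite le_eqVlt => /predU1P[<-|r0]; first by rewrite lebesgue_Cvec_point// mul0e.
have r0' := ltW r0.
have sr : 0 < (Num.sqrt r)^-1 by rewrite invr_gt0 sqrtr_gt0.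
have -> : [set u : Cvec R 1 | sqnorm u <= r] = vscale (Num.sqrt r)^-1 @^-1` (@cball R 1).
  apply/seteqP; split => u /=; rewrite /cball /= sqnorm_vscale exprVn sqr_sqrtr//;
   by rewrite ler_pdivrMl// mulr1.
rewrite lebesgue_Cvec_scale//; last exact: measurable_sqnorm_le.
by rewrite invrK (_ : (1 + 1)%N = 2)// sqr_sqrtr.
Qed.

Lemma measurable_sqnorm_lt n (r : R) : measurable [set u : Cvec R n | sqnorm u < r].
Proof.
rewrite (_ : [set _ | _] = (@sqnorm R n) @^-1` `]-oo, r[%classic).
  exact: (measurable_preimage (@measurable_sqnorm R n)).
by apply/seteqP; split => u /=; rewrite in_itv.
Qed.

(** The annuli below contain their inner circle, so the disc to be removed is open. Its area is
    approached from inside by closed discs. *)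
Lemma area_open_disc (r : R) : 0 <= r -> leb [set u | sqnorm u < r] = (r%:E * K)%E.
Proof.
have [mu muE] := lebesgue_Cvec_measure R 1.
rewrite le_eqVlt => /predU1P[<-|r0].
  rewrite (_ : [set _ | _] = set0) -?muE ?measure0 ?mul0e//.
  by apply/seteqP; split => u //=; rewrite ltNge sqnorm_ge0.
apply/eqP; rewrite eq_le; apply/andP; split.
  rewrite -(area_disc (ltW r0)) -muE.
  apply: le_measure; rewrite ?inE; [exact: measurable_sqnorm_lt|exact: measurable_sqnorm_le|].
  by move=> u /=; exact: ltW.
have [K0 Koo] := lebesgue_Cvec_cball R 1.
have KE : K = (fine K)%:E by rewrite fineK// ge0_fin_numE// ltW.
have k0 : 0 < fine K by rewrite -lte_fin -KE.
rewrite KE -EFinM; apply/lee_subgt0Pr => e e0; rewrite -EFinB.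
(* Lowering the squared radius by [e / fine K] costs at most [e] in area. *)
pose t := Num.max 0 (r - e / fine K).
have tr : t < r by rewrite gt_max r0 /= gtrBl divr_gt0.
have t0 : 0 <= t by rewrite le_max lexx.
apply: (@le_trans _ _ (leb [set u | sqnorm u <= t])).
  rewrite area_disc// KE -EFinM lee_fin.
  have -> : r * fine K - e = (r - e / fine K) * fine K by rewrite mulrBl divfK// gt_eqF.
  by apply: ler_wpM2r; [exact: ltW|rewrite /t le_max lexx orbT].
rewrite -muE; apply: le_measure; rewrite ?inE; [exact: measurable_sqnorm_le|exact: measurable_sqnorm_lt|].
by move=> u /= ut; exact: le_lt_trans ut tr.
Qed.

End disc.

(** * Splitting off the first complex coordinate *)

Section split.
Context (R : realType) (m : nat).
Local Notation V1 := (Cvec R 1).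
Local Notation Vm := (Cvec R m).
Local Notation V := (Cvec R m.+1).
Local Notation leb n := (@lebesgue_Cvec R n).

Definition vjoin (p : V1 * Vm) : V := row_mx (p.1 : 'rV_1) (p.2 : 'rV_m).
Definition vhead (u : V) : V1 := lsubmx (u : 'rV_(1 + m)).
Definition vtail (u : V) : Vm := rsubmx (u : 'rV_(1 + m)).

Lemma vheadK p : vhead (vjoin p) = p.1.
Proof. exact: row_mxKl. Qed.

Lemma vtailK p : vtail (vjoin p) = p.2.
Proof. exact: row_mxKr. Qed.

Lemma vjoinK u : vjoin (vhead u, vtail u) = u.
Proof. exact: (@hsubmxK _ 1 1 m u). Qed.

Lemma re_vhead u : re_coord ord0 (vhead u) = re_coord ord0 u.
Proof. by rewrite /re_coord mxE; congr (complex.Re (u _ _)); apply/val_inj. Qed.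

Lemma im_vhead u : im_coord ord0 (vhead u) = im_coord ord0 u.
Proof. by rewrite /im_coord mxE; congr (complex.Im (u _ _)); apply/val_inj. Qed.

Lemma re_vtail k u : re_coord k (vtail u) = re_coord (lift ord0 k) u.
Proof. by rewrite /re_coord mxE; congr (complex.Re (u _ _)); apply/val_inj. Qed.

Lemma im_vtail k u : im_coord k (vtail u) = im_coord (lift ord0 k) u.
Proof. by rewrite /im_coord mxE; congr (complex.Im (u _ _)); apply/val_inj. Qed.

Lemma sqnorm_split u : sqnorm u = sqnorm (vhead u) + sqnorm (vtail u).
Proof.
rewrite /sqnorm big_ord_recl big_ord_recl big_ord0 addr0 re_vhead im_vhead.
by congr (_ + _); apply: eq_bigr => k _; rewrite re_vtail im_vtail.
Qed.

Lemma sqnorm_vjoin p : sqnorm (vjoin p) = sqnorm p.1 + sqnorm p.2.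
Proof. by rewrite sqnorm_split vheadK vtailK. Qed.

Lemma measurable_vhead : measurable_fun setT vhead.
Proof.
apply/measurable_CvecP; split => k; rewrite (ord1 k).
  by rewrite (_ : _ \o _ = re_coord ord0);
    [exact: measurable_re_coord|apply/funext => u; exact: re_vhead].
by rewrite (_ : _ \o _ = im_coord ord0);
  [exact: measurable_im_coord|apply/funext => u; exact: im_vhead].
Qed.

Lemma measurable_vtail : measurable_fun setT vtail.
Proof.
apply/measurable_CvecP; split => k.
  by rewrite (_ : _ \o _ = re_coord (lift ord0 k));
    [exact: measurable_re_coord|apply/funext => u; exact: re_vtail].
by rewrite (_ : _ \o _ = im_coord (lift ord0 k));
  [exact: measurable_im_coord|apply/funext => u; exact: im_vtail].
Qed.

Lemma measurable_vjoin : measurable_fun setT vjoin.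
Proof.
apply/measurable_CvecP; split => k; case: (unliftP ord0 k) => [j ->|->].
- rewrite (_ : _ \o _ = re_coord j \o snd).
    by apply: measurableT_comp => //; exact: measurable_re_coord.
  by apply/funext => p /=; rewrite -re_vtail vtailK.
- rewrite (_ : _ \o _ = re_coord ord0 \o fst).
    by apply: measurableT_comp => //; exact: measurable_re_coord.
  by apply/funext => p /=; rewrite -re_vhead vheadK.
- rewrite (_ : _ \o _ = im_coord j \o snd).
    by apply: measurableT_comp => //; exact: measurable_im_coord.
  by apply/funext => p /=; rewrite -im_vtail vtailK.
- rewrite (_ : _ \o _ = im_coord ord0 \o fst).
    by apply: measurableT_comp => //; exact: measurable_im_coord.
  by apply/funext => p /=; rewrite -im_vhead vheadK.
Qed.

Lemma vjoin_cube a : vjoin @^-1` cube a = cube a `*` cube a.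
Proof.
apply/seteqP; split => p /=.
  move=> H; split => k /=.
    by rewrite (ord1 k) -[p.1]vheadK re_vhead im_vhead; exact: H.
  by rewrite -[p.2]vtailK re_vtail im_vtail; exact: H.
move=> [H1 H2] k; case: (unliftP ord0 k) => [j ->|->].
  by rewrite -re_vtail -im_vtail vtailK; exact: H2.
by rewrite -re_vhead -im_vhead vheadK; exact: H1.
Qed.

Lemma vjoinD p q : vjoin (vadd p.1 q.1, vadd p.2 q.2) = vadd (vjoin p) (vjoin q).
Proof. exact/esym/(@add_row_mx _ 1 1 m p.1 p.2 q.1 q.2). Qed.

(** The joined product measure is translation invariant, hence proportional to Lebesgue measure; the
    unit cubes show that the factor is 1. *)
Lemma lebesgue_Cvec_split
    (mu1 : {sigma_finite_measure set V1 -> \bar R})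
    (mum : {sigma_finite_measure set Vm -> \bar R}) (A : set V) :
  mu1 = leb 1 :> (set _ -> _) -> mum = leb m :> (set _ -> _) -> measurable A ->
  leb m.+1 A = product_measure1 mu1 mum (vjoin @^-1` A).
Proof.
move=> mu1E mumE mA.
pose mu : {measure set V -> \bar R} :=
  push_measure (product_measure1 mu1 mum) measurable_vjoin.
have smu : sigma_finite setT mu.
  apply: (@sigma_finite_push _ _ _ _ _ _ vjoin (fun u => (vhead u, vtail u))).
  - exact: sigma_finite_product.
  - by apply: measurable_fun_pair; [exact: measurable_vhead|exact: measurable_vtail].
  - by move=> [x y]; rewrite vheadK vtailK.
  - exact: vjoinK.
have tmu : translation_invariant mu.
  move=> v C mC; rewrite !push_measureE.
  pose sh (p : V1 * Vm) := (vadd p.1 (vhead v), vadd p.2 (vtail v)).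
  have msh : measurable_fun setT sh.
    apply: measurable_fun_pair.
      apply: (measurableT_comp (@measurable_vadd R 1) (measurable_fun_pair _ (measurable_cst _))).
      exact: measurable_fst.
    apply: (measurableT_comp (@measurable_vadd R m) (measurable_fun_pair _ (measurable_cst _))).
    exact: measurable_snd.
  rewrite (_ : vjoin @^-1` _ = sh @^-1` (vjoin @^-1` C)); last first.
    apply/seteqP; split => p /=; rewrite /sh (vjoinD p (vhead v, vtail v)) vjoinK //.
  have mC' : measurable (vjoin @^-1` C) by exact: measurable_preimage measurable_vjoin mC.
  rewrite -[LHS]/(push_measure (product_measure1 mu1 mum) msh (vjoin @^-1` C)).
  apply/esym; apply: product_measure_unique mC' => B D mB mD.
  rewrite push_measureE; transitivity
    (mu1 ((fun u : V1 => vadd u (vhead v)) @^-1` B) * mum ((fun u : Vm => vadd u (vtail v)) @^-1` D))%E.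
    rewrite -product_measure1E//.

    - apply: measurable_preimage mB.
      apply: (measurableT_comp (@measurable_vadd R 1) (measurable_fun_pair _ (measurable_cst _))).
      exact: measurable_id.
    - apply: measurable_preimage mD.
      apply: (measurableT_comp (@measurable_vadd R m) (measurable_fun_pair _ (measurable_cst _))).
      exact: measurable_id.
  have -> : mu1 ((fun u : V1 => vadd u (vhead v)) @^-1` B) = mu1 B.
    by rewrite mu1E; exact: (lebesgue_CvecD (vhead v) mB).
  have -> // : mum ((fun u : Vm => vadd u (vtail v)) @^-1` D) = mum D.
  by rewrite mumE; exact: (lebesgue_CvecD (vtail v) mD).
have c1 k : leb k (cube 1) = (2 ^+ (k + k))%:E by rewrite lebesgue_Cvec_cube// mulr1.
apply: (@mule_cancelr _ _ _ (leb m.+1 (cube 1))).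
- by rewrite c1 lte_fin exprn_gt0.
- by rewrite c1 ltry.
rewrite -[in RHS]/(mu A) (haar_lebesgue smu tmu mA (measurable_cube _ _)).
rewrite muleC; congr (_ * _)%E.
rewrite push_measureE vjoin_cube -[RHS]/(product_measure1 mu1 mum (cube 1 `*` cube 1)).
rewrite product_measure1E; try exact: measurable_cube.
rewrite -[RHS]/(mu1 (cube 1) * mum (cube 1))%E mu1E mumE !c1 -EFinM -exprD.
by congr (_ ^+ _)%:E; lia.
Qed.

End split.
Arguments vjoin {R m} p.
Arguments vhead {R m} u.
Arguments vtail {R m} u.

(** * The cone over a cap about the first axis *)

Section cap.
Context (R : realType) (m : nat).
Local Notation V1 := (Cvec R 1).
Local Notation Vm := (Cvec R m).
Local Notation V := (Cvec R m.+1).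
Local Notation leb n := (@lebesgue_Cvec R n).

(** The parameter [e] is the square of the overlap threshold, and the inequality is made homogeneous
    so that it describes a cone. The origin is left out because [cone] uses only radii r > 0; thus
    [cap 0] is the punctured unit ball. *)
Definition cap (e : R) : set V :=
  [set u | 0 < sqnorm u <= 1 /\ e * sqnorm u <= sqnorm (vhead u)].

Lemma measurable_cap e : measurable (cap e).
Proof.
rewrite (_ : cap e = ([set u | sqnorm u <= 1] `\` [set u | sqnorm u <= 0]) `&`
    ((fun u => e * sqnorm u - sqnorm (vhead u)) @^-1` `]-oo, 0]%classic)).
  apply: measurableI.
    by apply: measurableD; exact: measurable_sqnorm_le.
  apply: measurable_preimage => //; apply: measurable_funB.
    by apply: measurable_funM; [exact: measurable_cst|exact: measurable_sqnorm].
  by apply: measurableT_comp; [exact: measurable_sqnorm|exact: measurable_vhead].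
apply/seteqP; split => u; rewrite /cap /= in_itv /= subr_le0.
  by move=> [/andP[u0 u1] H]; split => //; split => //; apply/negP; rewrite -ltNge.
by move=> [[u1 /negP]]; rewrite -ltNge => u0 H; rewrite u0.
Qed.

Lemma area_discD (r b : R) (B : set V1) : 0 <= r -> measurable B ->
  B `<=` [set z | sqnorm z <= r] -> leb 1 B = (b%:E * leb 1 (@cball R 1))%E ->
  leb 1 ([set z | sqnorm z <= r] `\` B) = ((r - b)%:E * leb 1 (@cball R 1))%E.
Proof.
move=> r0 mB sB; have rE := area_disc r0; move: rE.
have [K0 Koo] := lebesgue_Cvec_cball R 1.
have -> : leb 1 (@cball R 1) = (fine (leb 1 (@cball R 1)))%:E by rewrite fineK// ge0_fin_numE// ltW.
have [mu muE] := lebesgue_Cvec_measure R 1; rewrite -muE => rE bE.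
rewrite measureD//; [|exact: measurable_sqnorm_le|by rewrite [ltLHS]rE -EFinM ltry].
by rewrite setIidr// [X in (X - _)%E]rE [X in (_ - X)%E]bE -!EFinM -EFinB mulrBl.
Qed.

(** With s = |w|^2, the condition e (|z|^2 + s) <= |z|^2 means |z|^2 >= b for b = e s / (1 - e). The
    section is the annulus of squared radii b and 1 - s, and 1 - s - b = 1 - s / (1 - e). *)
Lemma area_cap_section (e : R) (w : Vm) : 0 <= e -> e < 1 ->
  leb 1 (ysection (vjoin @^-1` cap e) w) =
  ((Num.max 0 (1 - sqnorm w / (1 - e)))%:E * leb 1 (@cball R 1))%E.
Proof.
move=> e0 e1; have e1' : 0 < 1 - e by rewrite subr_gt0.
have s0 := sqnorm_ge0 w; set s := sqnorm w.
pose b := e * s / (1 - e).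
have b0 : 0 <= b by apply: divr_ge0; [exact: mulr_ge0|exact: ltW].
have -> : s / (1 - e) = s + b by rewrite /b; field; rewrite (gt_eqF e1').
have sE z : (e * (z + s) <= z) = (b <= z).
  by rewrite /b ler_pdivrMr// -subr_ge0 -[RHS]subr_ge0; congr (0 <= _); ring.
have secE : ysection (vjoin @^-1` cap e) w =
    [set z : V1 | 0 < sqnorm z + s <= 1 /\ b <= sqnorm z].
  apply/seteqP; split => z; rewrite /ysection /= inE /cap /= sqnorm_vjoin vheadK /= -/s sE//.
rewrite secE.
(* Over w = 0 the missing origin punctures the section, which is then a disc without its centre. *)
have [s0'|s0'] := eqVneq s 0.
  have b00 : b = 0 by rewrite /b s0' mulr0 mul0r.
  rewrite (_ : [set _ | _] = [set z | sqnorm z <= 1] `\` [set z | sqnorm z <= 0]).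
    rewrite (@area_discD 1 0)//; [|exact: measurable_sqnorm_le| |by rewrite lebesgue_Cvec_point// mul0e].
      by rewrite s0' b00 addr0 !subr0 max_r.
    by move=> z /= z0; rewrite (le_trans z0).
  apply/seteqP; split => z /=; rewrite s0' b00 addr0.
    by move=> [/andP[z0 z1] _]; split => //; apply/negP; rewrite -ltNge.
  by move=> [z1 /negP]; rewrite -ltNge => z0; rewrite z0 z1 sqnorm_ge0.
have sp : 0 < s by rewrite lt0r s0' s0.
(* A negative value means that the inner radius exceeds the outer one, so the section is empty. *)
case: (leP 0 (1 - (s + b))) => sb; last first.
  rewrite mul0e (_ : [set _ | _] = set0); last first.
    by apply/seteqP; split => z //= -[/andP[z0 z1] zb]; lra.
  by have [mu muE] := lebesgue_Cvec_measure R 1; rewrite -muE measure0.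
rewrite (_ : [set _ | _] = [set z | sqnorm z <= 1 - s] `\` [set z | sqnorm z < b]).
  rewrite (@area_discD _ b).
  - by rewrite opprD addrA.
  - lra.
  - exact: measurable_sqnorm_lt.
  - by move=> z /=; lra.
  - exact: area_open_disc.
apply/seteqP; split => z /=.
  by move=> [/andP[z0 z1] zb]; split; [lra|apply/negP; rewrite -leNgt].
move=> [z1 /negP]; rewrite -leNgt => zb; split => //; apply/andP; split; last lra.
by have := sqnorm_ge0 z; lra.
Qed.

Lemma lebesgue_Cvec_cap (e : R) : 0 <= e -> e < 1 ->
  leb m.+1 (cap e) = (((1 - e) ^+ m)%:E * leb m.+1 (cap 0))%E.
Proof.
move=> e0 e1; have e1' : 0 < 1 - e by rewrite subr_gt0.
have [mu1 mu1E] := lebesgue_Cvec_measure R 1.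
have [mum mumE] := lebesgue_Cvec_measure R m.
have [K0 Koo] := lebesgue_Cvec_cball R 1.
pose F (w : Vm) : \bar R := ((Num.max 0 (1 - sqnorm w))%:E * leb 1 (@cball R 1))%E.
have F0 w : (0 <= F w)%E by apply: mule_ge0; [rewrite lee_fin le_max lexx|exact: ltW].
have mF : measurable_fun setT F.
  apply: emeasurable_funM; last exact: measurable_cst.
  apply/measurable_EFinP; apply: measurable_maxr; first exact: measurable_cst.
  by apply: measurable_funB; [exact: measurable_cst|exact: measurable_sqnorm].
pose c := Num.sqrt (1 - e).
have c0 : 0 < c by rewrite sqrtr_gt0.
have c2 : c ^+ 2 = 1 - e by apply: sqr_sqrtr; exact: ltW.
have vol e' : 0 <= e' -> e' < 1 -> leb m.+1 (cap e') =
    (\int[mum]_w F (vscale (Num.sqrt (1 - e'))^-1 w))%E.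
  move=> e'0 e'1; rewrite (lebesgue_Cvec_split mu1E mumE); last exact: measurable_cap.
  rewrite product_measure1E2; last first.
    by apply: measurable_preimage; [exact: measurable_vjoin|exact: measurable_cap].
  apply: eq_integral => w _; rewrite mu1E area_cap_section// /F sqnorm_vscale.
  by rewrite exprVn sqr_sqrtr ?subr_ge0 ?(ltW e'1)// mulrC.
rewrite (vol e)// (vol 0 (lexx _) ltr01) subr0 sqrtr1 invr1.
rewrite [in RHS](eq_integral F); last first.
  by move=> w _; rewrite /vscale rmorph1 scale1r.
have cV0 : 0 < c^-1 by rewrite invr_gt0.
have k0 : 0 <= (1 - e) ^+ m by apply: exprn_ge0; exact: ltW.
(* The change of variables is carried out on measures: pushing Lebesgue measure on C^m forward by w
   / c multiplies it by c^(2m) = (1 - e)^m. *)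
transitivity (\int[push_measure mum (measurable_vscale c^-1)]_w F w)%E.
  by rewrite ge0_integral_pushforward//; exact: measurable_vscale.
transitivity (\int[mscale (NngNum k0) mum]_w F w)%E; last first.
  by rewrite ge0_integral_mscale.
apply: eq_measure_integral => A mA _.
rewrite /mscale /= [RHS]/(_ * mum A)%E -[LHS]/(mum (vscale c^-1 @^-1` A)) mumE.
by rewrite lebesgue_Cvec_scale// invrK addnn -mul2n exprM c2.
Qed.

End cap.

(** * The uniform measure of a cap *)

Section complex_modulus.
Context (R : realType).
Implicit Types z w : R[i].

Definition sqmod z : R := complex.Re z ^+ 2 + complex.Im z ^+ 2.

Lemma sqmod_ge0 z : 0 <= sqmod z.
Proof. by rewrite addr_ge0 ?sqr_ge0. Qed.

Lemma sqmodM z w : sqmod (z * w) = sqmod z * sqmod w.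
Proof. by case: z w => [a b] [c d]; rewrite /sqmod /=; ring. Qed.

Lemma sqmodJ z : sqmod (conjc z) = sqmod z.
Proof. by case: z => a b; rewrite /sqmod /= sqrrN. Qed.

Lemma normcE z : ComplexField.Normc.normc z = Num.sqrt (sqmod z).
Proof. by case: z. Qed.

Lemma Re_mulJ z : complex.Re (z * conjc z) = sqmod z.
Proof. by case: z => a b; rewrite /sqmod /=; ring. Qed.

End complex_modulus.

(** * Invariance of Lebesgue measure under unitary maps *)

Section unitary.
Context (R : realType) (n : nat).
Local Notation V := (Cvec R n).
Local Open Scope sesquilinear_scope.

Lemma braketE (u v : V) : braket u v = ((v : 'rV_n) *m (u : 'rV_n)^t*) ord0 ord0.
Proof. by rewrite /braket mxE; apply: eq_bigr => k _; rewrite !mxE mulrC. Qed.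

Lemma sqnorm_unitary (U : 'M[R[i]]_n) (u : V) : U \is unitarymx ->
  sqnorm ((u : 'rV_n) *m U : V) = sqnorm u.
Proof.
move=> /unitarymxP UU; rewrite -!sqnormE !braketE trmx_mul map_mxM mulmxA.
by rewrite -(mulmxA (u : 'rV_n)) UU mulmx1.
Qed.

Lemma lebesgue_Cvec_unitary (U : 'M[R[i]]_n) (A : set V) : U \is unitarymx ->
  measurable A ->
  lebesgue_Cvec ((fun u : V => ((u : 'rV_n) *m U : V)) @^-1` A) = lebesgue_Cvec A.
Proof.
move=> UU mA; have Uunit := unitarymx_unit UU.
have [K0 Koo] := lebesgue_Cvec_cball R n.
apply: (mule_cancelr K0 Koo).
(* The unit ball is the test set: a unitary map preserves it, so the factor is 1. *)
rewrite (@lebesgue_Cvec_linear _ _ (fun u : V => ((u : 'rV_n) *m U : V))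
  (fun u : V => ((u : 'rV_n) *m invmx U : V)) A (@cball R n))//.
- rewrite muleC; congr (_ * lebesgue_Cvec _)%E.
  by apply/seteqP; split => u; rewrite /cball /= sqnorm_unitary.
- exact: measurable_mulmx.
- exact: measurable_mulmx.
- by move=> u; rewrite mulmxK.
- by move=> u; rewrite mulmxKV.
- by move=> u v; rewrite /vadd mulmxDl.
- exact: measurable_sqnorm_le.
Qed.

End unitary.

Section cap_of_vector.
Context (R : realType) (m : nat).
Local Notation V := (Cvec R m.+1).
Local Open Scope sesquilinear_scope.

Lemma sqnorm_vhead (u : V) : sqnorm (vhead u) = sqmod (u ord0 ord0).
Proof. by rewrite /sqnorm big_ord_recl big_ord0 addr0 re_vhead im_vhead. Qed.

(* Gram-Schmidt applied to the matrix with first row x and zeros below. *)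
Lemma unitary_to_first_axis (x : V) : sqnorm x = 1 ->
  exists2 U : 'M[R[i]]_m.+1, U \is unitarymx &
    forall w : V, sqmod (braket x ((w : 'rV_m.+1) *m U : V)) = sqnorm (vhead w).
Proof.
move=> x1.
pose A : 'M[R[i]]_m.+1 := \matrix_(i, j) if i == ord0 then x ord0 j else 0.
have rowA : row ord0 A = x by apply/rowP => j; rewrite !mxE eqxx.
pose U := schmidt A.
have UU : U \is unitarymx by exact: schmidt_unitarymx.
exists U => // w.
(* Row 0 of [A] lies in the span of the rows of [U] up to index 0, so x is a multiple a of row 0 of
   [U]. Both are unit vectors, hence |a| = 1, and the phase disappears in [sqmod]. *)
have /sub_rVP[a xE] : (row ord0 A <= row ord0 U)%MS.
  apply: submx_trans (row_schmidt_sub A ord0) _.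
  apply/sumsmx_subP => k; rewrite leqn0 => /eqP k0.
  by rewrite (_ : k = ord0) ?genmxE//; exact/val_inj.
rewrite rowA rowE in xE; set e := delta_mx _ _ in xE.
have UE : U *m U^t* = 1%:M by exact/unitarymxP.
have xtE : (x : 'rV_m.+1)^t* = conjc a *: (U^t* *m e^t*).
  by rewrite xE linearZ /= map_mxZ trmx_mul map_mxM.
have ee (w' : 'rV[R[i]]_m.+1) : (w' *m e^t*) ord0 ord0 = w' ord0 ord0.
  rewrite mxE (bigD1 ord0)//= big1 ?addr0; last first.
    by move=> k k0; rewrite !mxE (negbTE k0) andbF /= rmorph0 mulr0.
  by rewrite !mxE !eqxx /= rmorph1 mulr1.
have a1 : sqmod a = 1.
  rewrite -x1 -sqnormE braketE xtE {1}xE -scalemxAl -scalemxAr scalerA mulmxA.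
  rewrite -(mulmxA e) UE mulmx1 mxE ee.
  by rewrite /e mxE !eqxx mulr1 Re_mulJ.
rewrite braketE xtE -scalemxAr mxE sqmodM sqmodJ a1 mul1r.
by rewrite mulmxA -(mulmxA (w : 'rV_m.+1)) UE mulmx1 ee sqnorm_vhead.
Qed.

(** Cauchy-Schwarz by rotation: the overlap becomes the first coordinate of a unit vector. *)
Lemma sqmod_braket_le1 (x y : V) : sqnorm x = 1 -> sqnorm y = 1 ->
  sqmod (braket x y) <= 1.
Proof.
move=> /unitary_to_first_axis[U UU xU] y1.
pose w : V := (y : 'rV_m.+1) *m invmx U.
have yE : y = (w : 'rV_m.+1) *m U by rewrite mulmxKV ?unitarymx_unit.
rewrite yE xU -y1 yE sqnorm_unitary// [leRHS]sqnorm_split lerDl.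
exact: sqnorm_ge0.
Qed.

Definition cap_about (x : V) (e : R) : set V :=
  [set v | 0 < sqnorm v <= 1 /\ e * sqnorm v <= sqmod (braket x v)].

Lemma lebesgue_Cvec_cap_about (x : V) (e : R) : sqnorm x = 1 ->
  0 <= e -> e < 1 -> measurable (cap_about x e) ->
  lebesgue_Cvec (cap_about x e) =
  (((1 - e) ^+ m)%:E * lebesgue_Cvec (@cap R m 0))%E.
Proof.
move=> /unitary_to_first_axis[U UU xU] e0 e1 mcap.
rewrite -(lebesgue_Cvec_unitary UU mcap) -lebesgue_Cvec_cap//.
congr lebesgue_Cvec; apply/seteqP.
by split => w; rewrite /cap_about /cap /= sqnorm_unitary// xU.
Qed.

(** The punctured ball differs from the ball by a null set; positivity and finiteness allow division
    by its volume. *)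
Lemma lebesgue_Cvec_cap0 : (0 < lebesgue_Cvec (@cap R m 0))%E /\
  (lebesgue_Cvec (@cap R m 0) < +oo)%E.
Proof.
have [K0 Koo] := lebesgue_Cvec_cball R m.+1.
have [mu muE] := lebesgue_Cvec_measure R m.+1.
have mcap := @measurable_cap R m 0.
have mball := @measurable_sqnorm_le R m.+1 1.
have mpt := @measurable_sqnorm_le R m.+1 0.
rewrite -muE; split.
  apply: lt_le_trans (_ : mu (@cball R m.+1) <= _)%E; first by rewrite muE.
  have pt0 : mu [set u | sqnorm u <= 0] = 0%E by rewrite muE lebesgue_Cvec_point.
  rewrite -[leRHS]addr0 -[X in (_ <= _ + X)%E]pt0.
  apply: le_trans (measureU2 _ mcap mpt).
  apply: le_measure; rewrite ?inE//; first exact: measurableU.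
  move=> u u1; case: (leP (sqnorm u) 0) => u0; [by right|left].
  by split; [rewrite u0|rewrite mul0r sqnorm_ge0].
apply: le_lt_trans Koo; rewrite -muE; apply: le_measure; rewrite ?inE//.
by move=> u [/andP[]].
Qed.

Lemma braket_vscale (x u : V) c : sqmod (braket x (vscale c u)) = c ^+ 2 * sqmod (braket x u).
Proof.
rewrite (_ : braket x _ = (c%:C)%C * braket x u).
  by rewrite sqmodM /sqmod /= expr0n addr0.
by rewrite /braket mulr_sumr; apply: eq_bigr => k _; rewrite mxE mulrCA.
Qed.

Lemma csphereE (u : V) : csphere u = (sqnorm u = 1).
Proof.
rewrite /csphere /= cnormE; apply/propext; split => [|->]; last exact: sqrtr1.
by move=> H; rewrite -[LHS]sqr_sqrtr ?sqnorm_ge0// H expr1n.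
Qed.

Lemma cone_cap (x : V) (eps : R) : 0 <= eps ->
  cone ([set y | eps <= ComplexField.Normc.normc (braket x y)] `&` @csphere R m.+1) =
  cap_about x (eps ^+ 2).
Proof.
move=> eps0.
have E y : (eps <= ComplexField.Normc.normc (braket x y)) = (eps ^+ 2 <= sqmod (braket x y)).
  by rewrite normcE -[in LHS]ler_sqr ?nnegrE ?sqrtr_ge0// sqr_sqrtr ?sqmod_ge0.
apply/seteqP; split => v.
  move=> [r [u [r0 r1 [/= + +] ->]]]; rewrite E csphereE => xu u1.
  rewrite /cap_about /= -/(vscale r u) sqnorm_vscale braket_vscale u1 mulr1.
  rewrite exprn_gt0// exprn_ile1 ?(ltW r0)//; split => //.
  by rewrite mulrC ler_wpM2l// sqr_ge0.
move=> [/andP[v0 v1] H].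
have s0 : 0 < Num.sqrt (sqnorm v) by rewrite sqrtr_gt0.
have sn0 : Num.sqrt (sqnorm v) != 0 by rewrite gt_eqF.
(* Polar decomposition of v, legitimate because v is nonzero. *)
exists (Num.sqrt (sqnorm v)), (vscale (Num.sqrt (sqnorm v))^-1 v); split => //.
- by rewrite -[leRHS]sqrtr1; exact: ler_wsqrtr.
- split => /=.
    by rewrite E braket_vscale exprVn sqr_sqrtr ?(ltW v0)// ler_pdivlMl// mulrC.
  by rewrite csphereE sqnorm_vscale exprVn sqr_sqrtr ?(ltW v0)// mulVf// gt_eqF.
- by have := @vscaleK R m.+1 _ (invr_neq0 sn0) v; rewrite invrK => K; exact/esym/K.
Qed.

Lemma measurable_sqmod_braket d (T : measurableType d) (f g : T -> V) :
  measurable_fun setT f -> measurable_fun setT g ->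
  measurable_fun setT (fun t => sqmod (braket (f t) (g t))).
Proof.
move=> /measurable_CvecP[fr fi] /measurable_CvecP[gr gi].
apply: measurable_funD; apply: measurable_funX.
  rewrite (_ : (fun t => _) = fun t => \sum_k (re_coord k (f t) * re_coord k (g t)
      + im_coord k (f t) * im_coord k (g t))).
    by apply: measurable_sum => k; apply: measurable_funD; apply: measurable_funM;
      [exact: fr|exact: gr|exact: fi|exact: gi].
  apply/funext => t; rewrite /braket raddf_sum; apply: eq_bigr => k _.
  by rewrite /re_coord /im_coord; case: (f t _ _) (g t _ _) => [a b] [c c'] /=; rewrite mulNr opprK.
rewrite (_ : (fun t => _) = fun t => \sum_k (re_coord k (f t) * im_coord k (g t)
    - im_coord k (f t) * re_coord k (g t))).
  by apply: measurable_sum => k; apply: measurable_funB; apply: measurable_funM;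
    [exact: fr|exact: gi|exact: fi|exact: gr].
apply/funext => t; rewrite /braket raddf_sum; apply: eq_bigr => k _.
by rewrite /re_coord /im_coord; case: (f t _ _) (g t _ _) => [a b] [c c'] /=; rewrite mulNr.
Qed.

Lemma measurable_overlap d (T : measurableType d) (f g : T -> V) (eps : R) :
  measurable_fun setT f -> measurable_fun setT g ->
  measurable [set t | eps <= ComplexField.Normc.normc (braket (f t) (g t))].
Proof.
move=> mf mg.
rewrite (_ : [set _ | _] =
  (fun t => ComplexField.Normc.normc (braket (f t) (g t))) @^-1` `[eps, +oo[%classic).
  apply: measurable_preimage => //.
  rewrite (_ : (fun t => _) = @Num.sqrt R \o (fun t => sqmod (braket (f t) (g t)))).
    apply: measurableT_comp; last exact: measurable_sqmod_braket.
    by apply: continuous_measurable_fun; exact: sqrt_continuous.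
  by apply/funext => t /=; rewrite normcE.
by apply/seteqP; split => t /=; rewrite in_itv /= andbT.
Qed.

Lemma measurable_cap_about x e : measurable (cap_about x e).
Proof.
rewrite (_ : cap_about x e = ([set u | sqnorm u <= 1] `\` [set u | sqnorm u <= 0]) `&`
    ((fun u => e * sqnorm u - sqmod (braket x u)) @^-1` `]-oo, 0]%classic)).
  apply: measurableI.
    by apply: measurableD; exact: measurable_sqnorm_le.
  apply: measurable_preimage => //; apply: measurable_funB.
    by apply: measurable_funM; [exact: measurable_cst|exact: measurable_sqnorm].
  by apply: (@measurable_sqmod_braket _ _ (cst x) id); [exact: measurable_cst|exact: measurable_id].
apply/seteqP; split => u; rewrite /cap_about /= in_itv /= subr_le0.
  by move=> [/andP[u0 u1] H]; split => //; split => //; apply/negP; rewrite -ltNge.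
by move=> [[u1 /negP]]; rewrite -ltNge => u0 H; rewrite u0.
Qed.

Lemma measurable_csphere : measurable (@csphere R m.+1).
Proof.
rewrite (_ : csphere = (@sqnorm R m.+1) @^-1` [set 1]).
  exact: (measurable_preimage (@measurable_sqnorm R m.+1)).
by apply/seteqP; split => u; rewrite csphereE.
Qed.

Lemma surface_csphere : @surface R m.+1 (@csphere R m.+1) =
  ((2 * m.+1)%:R%:E * lebesgue_Cvec (@cap R m 0))%E.
Proof.
rewrite /surface; congr (_ * lebesgue_Cvec _)%E.
(* The whole sphere is presented as the cap of threshold 0 about the zero vector, so that [cone_cap]
   applies to it. *)
rewrite setIid (_ : csphere = [set y | 0 <= ComplexField.Normc.normc (braket (0 : 'rV_m.+1) y)] `&` csphere).
  rewrite cone_cap//; apply/seteqP; split => u [u1 _]; split => //.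
    by rewrite mul0r sqnorm_ge0.
  by rewrite expr0n mul0r sqmod_ge0.
apply/seteqP; split => u /=; last by case.
by move=> u1; split => //; rewrite normcE sqrtr_ge0.
Qed.

Lemma ediv_cancel (a b c : R) : a != 0 -> b != 0 ->
  ((a%:E * (c%:E * b%:E)) / (a%:E * b%:E) = c%:E)%E.
Proof.
move=> a0 b0; rewrite -!EFinM inver mulf_eq0 (negbTE a0) (negbTE b0) /= -EFinM.
by congr EFin; field; rewrite a0 b0.
Qed.

Lemma uniform_csphere_overlap (x : V) (eps : R) : csphere x -> 0 <= eps -> eps < 1 ->
  uniform_csphere [set y | eps <= ComplexField.Normc.normc (braket x y)] =
  ((1 - eps ^+ 2) ^+ m)%:E.
Proof.
rewrite csphereE => x1 eps0 eps1.
rewrite /uniform_csphere surface_csphere /surface cone_cap//.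
rewrite lebesgue_Cvec_cap_about ?sqr_ge0//; last 2 first.
- by rewrite exprn_ilt1.
- exact: measurable_cap_about.
have [c0 coo] := lebesgue_Cvec_cap0.
rewrite -[lebesgue_Cvec (cap 0)]fineK ?ge0_fin_numE ?(ltW c0)// ediv_cancel ?pnatr_eq0//.
by rewrite gt_eqF// fine_gt0// c0.
Qed.

Lemma uniform_csphere_csphere : uniform_csphere (@csphere R m.+1) = 1%E.
Proof.
rewrite /uniform_csphere surface_csphere.
have [c0 coo] := lebesgue_Cvec_cap0.
rewrite -[lebesgue_Cvec (cap 0)]fineK ?ge0_fin_numE ?(ltW c0)//.
rewrite -{1}[(fine _)%:E]mul1e ediv_cancel ?pnatr_eq0//.
by rewrite gt_eqF// fine_gt0// c0.
Qed.

End cap_of_vector.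

(** * Finite families of events *)

Section real_probability.
Context d (T : measurableType d) (R : realType) (P : probability T R).
Implicit Types A B : set T.

Definition pr A : R := fine (P A).

Lemma prE A : measurable A -> P A = (pr A)%:E.
Proof. by move=> mA; rewrite fineK// fin_num_measure. Qed.

Lemma pr_ge0 A : 0 <= pr A.
Proof. exact/fine_ge0/measure_ge0. Qed.

Lemma le_pr A B : measurable A -> measurable B -> A `<=` B -> pr A <= pr B.
Proof. by move=> mA mB AB; rewrite -lee_fin -!prE//; apply: le_measure; rewrite ?inE. Qed.

Lemma prT : pr setT = 1.
Proof. by rewrite /pr probability_setT. Qed.

Lemma pr0 : pr set0 = 0.
Proof. by rewrite /pr measure0. Qed.

Lemma pr_le1 A : measurable A -> pr A <= 1.
Proof. by move=> mA; rewrite -prT; apply: le_pr. Qed.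

Lemma pr_setDI A B : measurable A -> measurable B ->
  pr A = pr (A `\` B) + pr (A `&` B).
Proof.
move=> mA mB; apply: EFin_inj; rewrite EFinD -!prE//; last 2 first.
- exact: measurableI.
- exact: measurableD.
exact: measureDI.
Qed.

Lemma pr_setC A : measurable A -> pr (~` A) = 1 - pr A.
Proof.
move=> mA; rewrite -prT (pr_setDI measurableT mA) setTD setTI.
by rewrite addrK.
Qed.

Lemma pr_setU A B : measurable A -> measurable B ->
  pr (A `|` B) = pr A + pr B - pr (A `&` B).
Proof.
move=> mA mB; apply: EFin_inj; rewrite EFinB EFinD -!prE//; last 2 first.
- exact: measurableI.
- exact: measurableU.
by apply: measureUfinl => //; rewrite ltey_eq fin_num_measure.
Qed.

Lemma pr_setU_le A B : measurable A -> measurable B ->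
  pr (A `|` B) <= pr A + pr B.
Proof. by move=> mA mB; rewrite pr_setU// gerBl pr_ge0. Qed.

Lemma pr_bigsetU_le (I : Type) (s : seq I) (F : I -> set T) :
  (forall i, measurable (F i)) ->
  pr (\big[setU/set0]_(i <- s) F i) <= \sum_(i <- s) pr (F i).
Proof.
move=> mF; elim: s => [|a s IH]; first by rewrite !big_nil pr0.
rewrite !big_cons; apply: le_trans (pr_setU_le _ _) _ => //.
  by apply: bigsetU_measurable => i _.
by rewrite lerD2l.
Qed.

(** Inclusion-exclusion cut after pairs. The square of the size generously bounds the number of
    pairs, which suffices for an error k^2 p^2 in the recursion. *)
Lemma bonferroni (I : eqType) (s : seq I) (F : I -> set T) (c : R) :
  0 <= c -> (forall i, measurable (F i)) -> uniq s ->
  {in s &, forall i j, i != j -> pr (F i `&` F j) <= c} ->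
  \sum_(i <- s) pr (F i) - (size s)%:R ^+ 2 * c <=
  pr (\big[setU/set0]_(i <- s) F i).
Proof.
move=> c0 mF; elim: s => [|a s IH] /=.
  by rewrite !big_nil pr0 expr0n mul0r subr0.
move=> /andP[ans us] H; rewrite !big_cons.
have mU : measurable (\big[setU/set0]_(i <- s) F i) by apply: bigsetU_measurable.
have {}IH := IH us (fun i j is_ js => H i j (mem_behead (s := a :: s) is_) (mem_behead (s := a :: s) js)).
have HI : pr (F a `&` \big[setU/set0]_(i <- s) F i) <= (size s)%:R * c.
  rewrite big_distrr /=; apply: le_trans (pr_bigsetU_le _ _) _.
    by move=> i; exact: measurableI.
  rewrite -sum1_size natr_sum mulr_suml !big_seq.
  apply: ler_sum => i is_; rewrite mul1r; apply: H; rewrite ?mem_head ?inE ?is_ ?orbT//.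
  by apply: contra ans; move=> /eqP ->.
rewrite pr_setU//.
have nc0 : 0 <= (size s)%:R * c by rewrite mulr_ge0.
have -> : (size s).+1%:R ^+ 2 * c = (size s)%:R ^+ 2 * c + 2 * ((size s)%:R * c) + c.
  by rewrite -natr1; ring.
by lra.
Qed.

Section second_moment.
Context (I : choiceType) (s : seq I) (F : I -> set T) (p : R).
Hypothesis us : uniq s.
Hypothesis mF : forall i, measurable (F i).
Hypothesis prF : {in s, forall i, pr (F i) = p}.
Hypothesis prF2 : {in s &, forall i j, i != j -> pr (F i `&` F j) = p ^+ 2}.

(* Integrating M^2 1_N + 2 M X <= X^2 + M^2, where X counts the events that
   occur, N = {X = 0} and M = E[X]. *)
Lemma pr_none_pairwise_indep :
  pr (~` (\big[setU/set0]_(i <- s) F i)) * ((size s)%:R * p) <= 1.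
Proof.
set U := \big[setU/set0]_(i <- s) F i; set M := (size s)%:R * p.
have mU : measurable U by apply: bigsetU_measurable.
have mC : measurable (~` U) by exact: measurableC.
have [M0|M0] := leP M 0.
  by apply: le_trans (_ : 0 <= 1) => //; rewrite mulr_ge0_le0// pr_ge0.
have ind (A : set T) : measurable A -> measurable_fun setT (fun w => (\1_A w)%:E : \bar R).
  by move=> mA; apply/measurable_EFinP; exact: measurable_indic.
have int1 (A : set T) : measurable A -> (\int[P]_w (\1_A w)%:E = (pr A)%:E)%E.
  by move=> mA; rewrite integral_indic// setIT -prE.
pose L w : \bar R := ((M ^+ 2)%:E * (\1_(~` U) w)%:E
  + (2 * M)%:E * \sum_(i <- s) (\1_(F i) w)%:E)%E.
pose D w : \bar R := (\sum_(i <- s) \sum_(j <- s) (\1_(F i `&` F j) w)%:E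
  + (M ^+ 2)%:E)%E.
have mFF i j : measurable (F i `&` F j) by exact: measurableI.
have LD w : (L w <= D w)%E.
  pose X : R := \sum_(i <- s) \1_(F i) w.
  rewrite /L /D (_ : \sum_(i <- s) (\1_(F i) w)%:E = X%:E)%E; last by rewrite sumEFin.
  rewrite (_ : \sum_(i <- s) \sum_(j <- s) _ = (X ^+ 2)%:E)%E; last first.
    rewrite expr2 /X mulr_suml -sumEFin; apply: eq_bigr => i _.
    by rewrite mulr_sumr -sumEFin; apply: eq_bigr => j _; rewrite indicI.
  rewrite -!EFinM -!EFinD lee_fin.
  have X0 : 0 <= X by apply: sumr_ge0 => i _; rewrite indicE.
  have [Uw|nUw] := pselect (U w).
    rewrite indicE memNset ?mulr0 ?add0r; last by rewrite /setC /=; apply.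
    by have := sqr_ge0 (X - M); rewrite sqrrB; lra.
  rewrite indicE mem_set// mulr1.
  rewrite (_ : X = 0); first by lra.
  rewrite /X big_seq; apply: big1 => i Qi; rewrite indicE memNset// => Fiw; apply: nUw.
  by rewrite /U -bigcup_seq; exists i.
have X_ge0 w : (0 <= \sum_(i <- s) (\1_(F i) w)%:E :> \bar R)%E.
  by apply: sume_ge0 => i _; rewrite lee_fin.
have mX : measurable_fun setT (fun w => \sum_(i <- s) (\1_(F i) w)%:E : \bar R)%E.
  by apply: emeasurable_sum => i; exact: ind.
have mXX : measurable_fun setT
    (fun w => \sum_(i <- s) \sum_(j <- s) (\1_(F i `&` F j) w)%:E : \bar R)%E.
  by apply: emeasurable_sum => i; apply: emeasurable_sum => j; exact: ind.
have M2 : 0 <= M ^+ 2 by exact: sqr_ge0.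
have M_ge0 : 0 <= 2 * M by rewrite mulr_ge0// ltW.
have EX : (\int[P]_w \sum_(i <- s) (\1_(F i) w)%:E = M%:E)%E.
  rewrite ge0_integral_sum//; last by move=> i; exact: ind.
  rewrite big_seq (eq_bigr (fun=> p%:E)); last by move=> i Qi; rewrite int1// prF.
  by rewrite -big_seq sumEFin big_const_seq count_predT iter_addr_0 /M mulr_natl.
have EL : (\int[P]_w L w = (M ^+ 2 * pr (~` U) + 2 * M * M)%:E)%E.
  have mI := ind _ mC.
  have mcI : measurable_fun setT (fun w => (M ^+ 2)%:E * (\1_(~` U) w)%:E : \bar R)%E.
    by apply: emeasurable_funM => //; exact: measurable_cst.
  have mcX : measurable_fun setT
      (fun w => (2 * M)%:E * \sum_(i <- s) (\1_(F i) w)%:E : \bar R)%E.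
    by apply: emeasurable_funM => //; exact: measurable_cst.
  have cI0 w : (0 <= (M ^+ 2)%:E * (\1_(~` U) w)%:E :> \bar R)%E.
    by rewrite -EFinM lee_fin mulr_ge0.
  have cX0 w : (0 <= (2 * M)%:E * \sum_(i <- s) (\1_(F i) w)%:E :> \bar R)%E.
    by apply: mule_ge0.
  rewrite ge0_integralD// ge0_integralZl// ge0_integralZl// int1// EX.
  by rewrite -!EFinM -EFinD.
(* In E[X^2] the diagonal terms contribute M and the off-diagonal ones at most M^2, by pairwise
   independence. *)
have ED : (\int[P]_w D w <= (M + M ^+ 2 + M ^+ 2)%:E)%E.
  rewrite ge0_integralD//; last first.
    by move=> w _; do 2 (apply: sume_ge0 => ? _); rewrite lee_fin.
  have PT : (P : {measure set T -> \bar R}) setT = 1%E by exact: probability_setT.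
  rewrite integral_cst// PT mule1 EFinD leeD2r//.
  rewrite ge0_integral_sum//; last 2 first.
  - by move=> i; apply: emeasurable_sum => j; exact: ind.
  - by move=> i w _; apply: sume_ge0 => j _; rewrite lee_fin.
  rewrite (_ : (M + M ^+ 2)%:E = \sum_(i <- s) (p + M * p)%:E)%E; last first.
    rewrite sumEFin big_const_seq count_predT iter_addr_0 -mulr_natl /M; congr EFin; ring.
  rewrite !big_seq; apply: lee_sum => i Qi.
  rewrite ge0_integral_sum//; last by move=> j; exact: ind.
  rewrite (bigD1_seq i)//= int1// setIid prF// EFinD leeD2l//.
  apply: le_trans (_ : \sum_(j <- s) (p ^+ 2)%:E <= _)%E.
    rewrite big_seq_cond [leRHS]big_seq; apply: (@le_trans _ _ (\sum_(j <- s | (j \in s) && (j != i)) (p ^+ 2)%:E)%E).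
      by apply: lee_sum => j /andP[js ji]; rewrite int1// prF2// eq_sym.
    by apply: lee_sum_nneg => j _ _; rewrite lee_fin sqr_ge0.
  by rewrite sumEFin lee_fin big_const_seq count_predT iter_addr_0
    [leRHS](_ : _ = p ^+ 2 *+ size s)// -mulr_natl /M; ring.
have L0 w : (0 <= L w)%E.
  by apply: adde_ge0; [rewrite -EFinM lee_fin mulr_ge0|exact: mule_ge0].
have D0 w : (0 <= D w)%E by exact: le_trans (L0 w) (LD w).
have mL : measurable_fun setT L.
  apply: emeasurable_funD; apply: emeasurable_funM; try exact: measurable_cst.
    exact: ind.
  exact: mX.
have mD : measurable_fun setT D.
  by apply: emeasurable_funD; [exact: mXX|exact: measurable_cst].
have : (\int[P]_w L w <= (M + M ^+ 2 + M ^+ 2)%:E)%E.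
  by apply: le_trans ED; exact: ge0_le_integral.
rewrite EL lee_fin => H.
(* After cancelling 2 M^2, the integrated inequality reads M^2 P(N) <= M. *)
rewrite -(ler_pM2r M0) mul1r.
have -> : pr (~` U) * M * M = M ^+ 2 * pr (~` U) by ring.
have E : 2 * M * M = M ^+ 2 + M ^+ 2 by ring.
by rewrite E in H; lra.
Qed.

End second_moment.

End real_probability.

(** * Overlaps of independent uniform vectors *)

Section overlaps.
Context (R : realType) (disp : measure_display) (Omega : measurableType disp).
Context (P : probability Omega R) (m d : nat).
Local Notation V := (Cvec R m.+1).
Variable E : 'I_d -> {RV P >-> V}.
Hypothesis E_unif : forall i, uniform_on_csphere (E i).
Hypothesis E_indep : mutually_independent E.

Local Notation pr := (pr P).

Lemma measurable_E i : measurable_fun setT (E i : Omega -> V).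
Proof. exact: measurable_funP. Qed.

Lemma measurable_E_preimage i (A : set V) : measurable A -> measurable (E i @^-1` A).
Proof. exact/measurable_preimage/measurable_E. Qed.

(** A pi-system generating the events that depend only on the vectors other than [E l]. *)
Definition others_system (l : 'I_d) : set (set Omega) :=
  [set B | exists2 A : 'I_d -> set V, (forall i, measurable (A i)) &
    B = \bigcap_(i in [set` [set~ l]%SET]) (E i @^-1` A i)].

Lemma others_system_measurable l : others_system l `<=` measurable.
Proof.
move=> B [A mA ->]; apply: fin_bigcap_measurable => // i _.
exact: measurable_E_preimage.
Qed.

Lemma others_system_setI l : setI_closed (others_system l).
Proof.
move=> _ _ [A mA ->] [A' mA' ->]; exists (fun i => A i `&` A' i).
  by move=> i; exact: measurableI.
by rewrite -bigcapI; apply: eq_bigcapr => i _; rewrite preimage_setI.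
Qed.

Lemma others_systemT l : others_system l setT.
Proof.
by exists (fun=> setT) => //; apply/esym/seteqP; split => // w _ i _.
Qed.

(** As functions of [B], both sides are finite measures, and mutual independence makes them agree on
    the pi-system. *)
Lemma others_indep l (B : set Omega) (C : set V) :
  <<s others_system l >> B -> measurable C ->
  P (B `&` E l @^-1` C) = (P B * P (E l @^-1` C))%E.
Proof.
move=> sB mC; have mEC := measurable_E_preimage l mC.
pose m1 : {measure set Omega -> \bar R} := mrestr P mEC.
have k0 : 0 <= pr (E l @^-1` C) by exact: pr_ge0.
pose m2 : {measure set Omega -> \bar R} := mscale (NngNum k0) P.
have : m1 B = m2 B.
  apply: (@g_sigma_algebra_measure_unique _ R Omega (others_system l)
    (@others_system_measurable l) (fun=> setT) _ _ m1 m2 (@others_system_setI l)) => //.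
  - by move=> _; exact: others_systemT.
  - by apply/seteqP; split => // w _; exists 0%N.
  - move=> _ [A mA ->]; rewrite /m1 /m2 /= /mrestr /mscale /=.
    rewrite -prE// (E_indep _ mA).
    pose A' i := if i == l then C else A i.
    have mA' i : measurable (A' i) by rewrite /A'; case: ifP.
    rewrite (_ : _ `&` _ = \bigcap_(i in [set` [set: 'I_d]%SET]) (E i @^-1` A' i)).
      rewrite (E_indep _ mA') (bigD1 l) ?inE//= /A' eqxx; congr (_ * _)%E.
      apply: eq_big => [i|i]; first by rewrite !inE.
      by move=> /andP[_ il]; rewrite (negbTE il).
    apply/seteqP; split => w /=.
      move=> [H Hl] i _; rewrite /A'; case: eqVneq => [->//|il].
      by apply: H; rewrite /= !inE.
    move=> H; split; last by have := H l; rewrite /A' eqxx /= inE; exact.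
    move=> i /=; rewrite !inE => il.
    by have := H i; rewrite /A' (negbTE il) /= inE; exact.
  - move=> _; rewrite /m1 /= /mrestr setTI.
    by rewrite (@le_lt_trans _ _ 1%E) ?ltry//; exact: probability_le1.
by rewrite /m1 /m2 /= /mrestr /mscale /= -prE// muleC.
Qed.

Lemma others_system_E l k (C : set V) : k != l -> measurable C ->
  <<s others_system l >> (E k @^-1` C).
Proof.
move=> kl mC; apply: sub_sigma_algebra.
exists (fun i => if i == k then C else setT); first by move=> i; case: ifP.
apply/seteqP; split => w /=.
  by move=> H i _; case: eqVneq => [->|].
by move=> /(_ k); rewrite eqxx /= !inE; apply.
Qed.

Definition overlap (eps : R) (i j : 'I_d) : set Omega :=
  [set w | eps <= ComplexField.Normc.normc (braket (E i w) (E j w))].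

Lemma measurable_overlap_E eps i j : measurable (overlap eps i j).
Proof. by apply: measurable_overlap; exact: measurable_E. Qed.

(** Both vectors remain measurable when the sample space carries only the sigma-algebra generated by
    the other vectors, so the general measurability lemma applies there. *)
Lemma others_system_overlap eps l i j : i != l -> j != l ->
  <<s others_system l >> (overlap eps i j).
Proof.
move=> il jl.
have mE k : k != l ->
    measurable_fun setT (E k : g_sigma_algebraType (others_system l) -> V).
  by move=> kl _ C mC; rewrite setTI; exact: others_system_E.
exact: (measurable_overlap eps (mE _ il) (mE _ jl)).
Qed.

Lemma overlapC eps i j : overlap eps i j = overlap eps j i.
Proof.
apply/seteqP; suff H w : ComplexField.Normc.normc (braket (E i w) (E j w)) =
    ComplexField.Normc.normc (braket (E j w) (E i w)).
  by split => w; rewrite /overlap /= H.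
rewrite !normcE -[in LHS]sqmodJ; congr (Num.sqrt (sqmod _)).
rewrite /braket rmorph_sum; apply: eq_bigr => k _.
by rewrite rmorphM /= conjcK mulrC.
Qed.

Lemma P_csphere i : P (E i @^-1` @csphere R m.+1) = 1%E.
Proof.
have := E_unif i (@measurable_csphere R m).
by rewrite uniform_csphere_csphere.
Qed.

Lemma pr_csphere i : pr (E i @^-1` @csphere R m.+1) = 1.
Proof.
apply: EFin_inj; rewrite -prE ?P_csphere//.
by apply: measurable_E_preimage; exact: measurable_csphere.
Qed.

(** Restricted to [B], the joint law of [E i] and [E l] is a product, as [B] and [E i] are
    independent of [E l]. Each section of the overlap set over a unit vector has the same measure p,
    so integration gives p P(B). Since [B] may involve [E i], this yields both pairwise independence
    and the recursion. *)
Lemma pr_overlap_indep eps l i (B : set Omega) : 0 <= eps -> eps < 1 -> i != l ->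
  <<s others_system l >> B ->
  pr (B `&` overlap eps i l) = (1 - eps ^+ 2) ^+ m * pr B.
Proof.
move=> eps0 eps1 il sB.
have mB : measurable B.
  exact: (smallest_sub (@sigma_algebra_measurable _ Omega) (@others_system_measurable l) sB).
have mS := @measurable_csphere R m.
have mES := measurable_E_preimage i mS.
pose muB : {measure set Omega -> \bar R} := mrestr P mB.
have mEE : measurable_fun setT (fun w => (E i w, E l w) : V * V).
  by apply: measurable_fun_pair; exact: measurable_E.
pose joint : {measure set (V * V) -> \bar R} := push_measure muB mEE.
pose nu1' : {measure set V -> \bar R} := push_measure muB (measurable_E i).
have snu1 : sigma_finite setT nu1'.
  exists (fun=> setT); first by rewrite bigcup_const//; exists 0%N.
  move=> _; split => //; rewrite push_measureE /= /mrestr preimage_setT setTI.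
  by rewrite (@le_lt_trans _ _ 1%E) ?ltry//; exact: probability_le1.
pose nu1 := sigma_finite_bundle snu1.
pose nu2 := distribution P (E l).
(* The first vector is confined to the sphere because the section has measure p only for unit
   vectors; the discarded event is null. *)
pose D : set (V * V) := [set p | eps <= ComplexField.Normc.normc (braket p.1 p.2)]
   `&` (fst @^-1` @csphere R m.+1).
have mD : measurable D.
  apply: measurableI; last exact: measurable_preimage.
  by apply: measurable_overlap.
have jointE : product_measure1 nu1 nu2 D = joint D.
  apply: product_measure_unique mD => C C' mC mC'.
  rewrite push_measureE /= /mrestr.
  rewrite (_ : _ `&` B = (B `&` E i @^-1` C) `&` E l @^-1` C'); last first.
    by apply/seteqP; split => w /= [[? ?] ?].
  rewrite others_indep//; last first.
    apply: (@measurableI _ (g_sigma_algebraType (others_system l))) => //.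
    exact: others_system_E.
  congr (_ * _)%E.
  by rewrite -[RHS]/(P (E i @^-1` C `&` B)) setIC.
have PB : P (B `&` E i @^-1` @csphere R m.+1) = P B.
  rewrite !prE//; last exact: measurableI.
  congr EFin; rewrite [RHS](@pr_setDI _ _ _ _ _ (E i @^-1` @csphere R m.+1))//.
  suff -> : pr (B `\` E i @^-1` @csphere R m.+1) = 0 by rewrite add0r.
  apply/eqP; rewrite eq_le pr_ge0 andbT.
  rewrite (_ : 0 = pr (~` (E i @^-1` @csphere R m.+1))); last first.
    by rewrite pr_setC// pr_csphere subrr.
  apply: le_pr; [exact: measurableD|exact: measurableC|by move=> w []].
have joint_pr : joint D = (pr (B `&` overlap eps i l))%:E.
  rewrite push_measureE /= /mrestr.
  pose S := E i @^-1` @csphere R m.+1.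
  rewrite -prE; last by apply: measurableI => //; exact: measurable_overlap_E.
  apply/esym; have mO := measurable_overlap_E eps i l.
  rewrite prE; last exact: measurableI.
  rewrite (_ : _ `&` B = B `&` overlap eps i l `&` S); last first.
    by apply/seteqP; split => w /= [[? ?] ?].
  rewrite [RHS]prE; last by apply: measurableI => //; exact: measurableI.
  congr EFin; rewrite (@pr_setDI _ _ _ _ _ S)//; last exact: measurableI.
  rewrite (_ : pr (_ `\` S) = 0) ?add0r//.
  apply/eqP; rewrite eq_le pr_ge0 andbT.
  rewrite (_ : 0 = pr (~` S)); last by rewrite pr_setC// pr_csphere subrr.
  by apply: le_pr; [apply: measurableD => //; exact: measurableI|exact: measurableC|move=> w []].
apply: EFin_inj; rewrite -joint_pr -jointE.
rewrite (@product_measure1_cst _ _ _ _ _ nu1 nu2 D (@csphere R m.+1)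
  ((1 - eps ^+ 2) ^+ m)%:E) //.
- rewrite [X in (X * _)%E](_ : _ = P B); last first.
    by rewrite -[LHS]/(P (E i @^-1` @csphere R m.+1 `&` B)) setIC.
  rewrite prE//.
  by rewrite -EFinM mulrC.
- by rewrite lee_fin exprn_ge0// subr_ge0 exprn_ile1// ltW.
- move=> x xS; rewrite /nu2 -(uniform_csphere_overlap xS eps0 eps1).
  rewrite -[LHS]/(distribution P (E l) _) (E_unif l); last by apply: measurable_xsection.
  congr uniform_csphere; apply/seteqP; split => y; rewrite /xsection /= inE /D /=.
    by case.
  by [].
- move=> x xS; rewrite (_ : xsection _ _ = set0) ?measure0//.
  by apply/seteqP; split => y; rewrite /xsection /= inE /D //= => -[].
Qed.

Lemma pr_overlap eps i l : 0 <= eps -> eps < 1 -> i != l ->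
  pr (overlap eps i l) = (1 - eps ^+ 2) ^+ m.
Proof.
move=> eps0 eps1 il; have := @pr_overlap_indep eps l i setT eps0 eps1 il.
rewrite setTI prT mulr1; apply.
exact: (@measurableT _ (g_sigma_algebraType (others_system l))).
Qed.

Lemma pr_overlap2 eps (i l j k : 'I_d) : 0 <= eps -> eps < 1 -> (i < l)%N -> (j < k)%N ->
  (i, l) != (j, k) ->
  pr (overlap eps i l `&` overlap eps j k) = ((1 - eps ^+ 2) ^+ m) ^+ 2.
Proof.
move=> eps0 eps1 il jk ne.
have il' : i != l by apply: contraTneq il => ->; rewrite ltnn.
have jk' : j != k by apply: contraTneq jk => ->; rewrite ltnn.
(* Two distinct increasing pairs share at most one index: either l is absent from (j, k), or i is.
   The absent vector is the one to integrate out. *)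
have [/andP[lj lk]|H] := boolP ((l != j) && (l != k)).
  rewrite setIC pr_overlap_indep//; first by rewrite pr_overlap// expr2.
  by apply: others_system_overlap; rewrite eq_sym.
rewrite (overlapC eps i l) setIC pr_overlap_indep 1?eq_sym//.
  by rewrite pr_overlap// expr2.
have {}H : l = j \/ l = k.
  by move: H; rewrite negb_and !negbK => /orP[/eqP|/eqP]; [left|right].
apply: others_system_overlap; apply/eqP => ji; subst i; case: H => lE; subst l.
- by rewrite eqxx in il'.
- by rewrite eqxx in ne.
- by have := ltn_trans il jk; rewrite ltnn.
- by rewrite eqxx in il'.
Qed.

End overlaps.

(** * The event that no overlap occurs, and the maximal overlap *)

Section eta.
Context (R : realType) (disp : measure_display) (Omega : measurableType disp).
Context (P : probability Omega R) (m d : nat).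
Local Notation V := (Cvec R m.+1).
Variable E : 'I_d -> {RV P >-> V}.
Hypothesis E_unif : forall i, uniform_on_csphere (E i).
Hypothesis E_indep : mutually_independent E.
Local Notation pr := (pr P).
Local Notation overlap := (overlap E).

(** Only the first [k] vectors are compared, so that the recursion over [k] stays within one family
    of [d] vectors. *)
Definition none (eps : R) (k : nat) : set Omega :=
  ~` \big[setU/set0]_(p : 'I_d * 'I_d | (p.1 < p.2)%N && (p.2 < k)%N) overlap eps p.1 p.2.

Lemma mem_none eps k w : none eps k w <->
  forall i j : 'I_d, (i < j)%N -> (j < k)%N -> ~ overlap eps i j w.
Proof.
rewrite /none -bigcup_seq_cond; split=> [H i j ij jk O|H [[i j] /= /andP[_ /andP[ij jk]] O]].
  by apply: H; exists (i, j) => //=; rewrite mem_index_enum ij jk.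
exact: H O.
Qed.

Lemma measurable_none eps k : measurable (none eps k).
Proof.
apply: measurableC; apply: bigsetU_measurable => p _.
exact: measurable_overlap_E.
Qed.

Lemma none0 eps : none eps 0 = setT.
Proof. by apply/seteqP; split => // w _; apply/mem_none => i j _. Qed.

Definition hit eps (l : 'I_d) : set Omega :=
  \big[setU/set0]_(i : 'I_d | (i < l)%N) overlap eps i l.

Lemma mem_hit eps l w : hit eps l w <-> exists2 i : 'I_d, (i < l)%N & overlap eps i l w.
Proof.
rewrite /hit -bigcup_seq_cond; split=> [[i /= /andP[_ il] O]|[i il O]]; first by exists i.
by exists i => //=; rewrite mem_index_enum.
Qed.

Lemma none_succ eps (l : 'I_d) : none eps l.+1 = none eps l `\` hit eps l.
Proof.
apply/seteqP; split => w.
  move=> /mem_none H; split.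
    by apply/mem_none => i j ij jl; apply: H => //; exact: ltnW.
  by move=> /mem_hit[i il]; exact: H.
move=> [/mem_none H nh]; apply/mem_none => i j ij.
rewrite ltnS leq_eqVlt => /orP[/eqP/val_inj jl|jl]; last exact: H.
by subst j => O; apply: nh; apply/mem_hit; exists i.
Qed.

Lemma measurable_hit eps l : measurable (hit eps l).
Proof. by apply: bigsetU_measurable => i _; exact: measurable_overlap_E. Qed.

Lemma others_system_none eps (l : 'I_d) : <<s others_system E l >> (none eps l).
Proof.
apply: (@measurableC _ (g_sigma_algebraType (others_system E l))).
apply: bigsetU_measurable => -[i j] /= /andP[ij jl].
apply: others_system_overlap; apply/eqP => e; subst.
  by have := ltn_trans ij jl; rewrite ltnn.
by rewrite ltnn in jl.
Qed.

Section recursion.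
Variable eps : R.
Hypotheses (eps0 : 0 <= eps) (eps1 : eps < 1).
Local Notation p := ((1 - eps ^+ 2) ^+ m).

Lemma sum_below (l : 'I_d) (c : R) : \sum_(i < d | (i < l)%N) c = l%:R * c.
Proof.
rewrite -(big_ord_widen d (fun=> c) (ltnW (ltn_ord l))).
by rewrite sumr_const card_ord mulr_natl.
Qed.

Lemma none_hitE (l : 'I_d) : none eps l `&` hit eps l =
  \big[setU/set0]_(i : 'I_d | (i < l)%N) (none eps l `&` overlap eps i l).
Proof. by rewrite /hit big_distrr. Qed.

Lemma pr_none_overlap (i l : 'I_d) : (i < l)%N ->
  pr (none eps l `&` overlap eps i l) = p * pr (none eps l).
Proof.
move=> il; apply: pr_overlap_indep => //; last exact: others_system_none.
by apply: contraTneq il => ->; rewrite ltnn.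
Qed.

(** Union bound over the earlier vectors: each new overlap is independent of the event that none
    occurred before. *)
Lemma pr_none_ge (l : 'I_d) :
  pr (none eps l) * (1 - l%:R * p) <= pr (none eps l.+1).
Proof.
have mN := measurable_none eps l.
have := @pr_setDI _ _ _ P _ _ mN (measurable_hit eps l).
rewrite -none_succ => H.
have : pr (none eps l `&` hit eps l) <= l%:R * p * pr (none eps l).
  rewrite none_hitE -big_filter; apply: le_trans (pr_bigsetU_le _ _ _) _.
    by move=> i; apply: measurableI => //; exact: measurable_overlap_E.
  rewrite big_filter (eq_bigr (fun=> p * pr (none eps l))).
    by rewrite sum_below mulrA.
  by move=> i il; exact: pr_none_overlap.
by move: H; lra.
Qed.

(** Bonferroni over the earlier vectors, where two overlaps with the same new vector occur together
    with probability p^2. *)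
Lemma pr_none_le (l : 'I_d) :
  pr (none eps l.+1) <= pr (none eps l) * (1 - l%:R * p) + l%:R ^+ 2 * p ^+ 2.
Proof.
have mN := measurable_none eps l.
have := @pr_setDI _ _ _ P _ _ mN (measurable_hit eps l).
rewrite -none_succ => H.
suff : l%:R * p * pr (none eps l) - l%:R ^+ 2 * p ^+ 2 <= pr (none eps l `&` hit eps l).
  by move: H; lra.
rewrite none_hitE -big_filter.
set s := [seq i <- _ | _].
have sE : (size s)%:R = l%:R :> R.
  rewrite -[RHS]mulr1 -(sum_below l 1) -big_filter -/s.
  by rewrite big_const_seq count_predT iter_addr_0.
have ps i : i \in s -> (i < l)%N by rewrite mem_filter => /andP[].
apply: le_trans (@bonferroni _ _ _ P _ s _ (p ^+ 2) _ _ _ _).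
- rewrite sE lerD2r big_seq (eq_bigr (fun=> p * pr (none eps l))).
    by rewrite -big_seq big_const_seq count_predT iter_addr_0 -[_ *+ size s]mulr_natl sE mulrA.
  by move=> i /ps il; exact: pr_none_overlap.
- exact: sqr_ge0.
- by move=> i; apply: measurableI => //; exact: measurable_overlap_E.
- by rewrite filter_uniq// index_enum_uniq.
- move=> i j /ps il /ps jl ij; rewrite -(pr_overlap2 E_unif E_indep eps0 eps1 il jl); last first.
    by apply: contra ij => /eqP[->].
  apply: le_pr.
  + by do 2 (apply: measurableI => //); exact: measurable_overlap_E.
  + by apply: measurableI => //; exact: measurable_overlap_E.
  + by move=> w [[_ ?] [_ ?]].
Qed.

Lemma pr_none_second_moment : (2 <= d)%N ->
  pr (none eps d) * (d%:R ^+ 2 * p) <= 4.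
Proof.
move=> d2; have p0 : 0 <= p by rewrite exprn_ge0// subr_ge0 exprn_ile1// ltW.
pose s := [seq q : 'I_d * 'I_d <- index_enum _ | (q.1 < q.2)%N && (q.2 < d)%N].
have ps q : q \in s -> (q.1 < q.2)%N by rewrite mem_filter => /andP[/andP[]].
have H : pr (none eps d) * ((size s)%:R * p) <= 1.
  rewrite /none -big_filter -/s.
  apply: pr_none_pairwise_indep.
  - by rewrite filter_uniq// index_enum_uniq.
  - by move=> q; exact: measurable_overlap_E.
  - move=> q /ps qs; apply: pr_overlap => //.
    by apply: contraTneq qs => ->; rewrite ltnn.
  - move=> q q' /ps qs /ps qs' ne; apply: pr_overlap2 => //.
have sE : size s = 'C(d, 2).
  rewrite -bin2_sum big_mkord -sum1_size big_filter.
  rewrite -(pair_big_dep xpredT (fun i j : 'I_d => (i < j)%N && (j < d)%N) (fun _ _ => 1%N)) /=.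
  rewrite (exchange_big_dep xpredT) //=; apply: eq_bigr => j _.
  under eq_bigl do rewrite ltn_ord andbT.
  rewrite -(big_ord_widen d (fun=> 1%N) (ltnW (ltn_ord j))).
  by rewrite sum1_card card_ord.
(* Origin of the constant 4: d^2 <= 2 d (d - 1) as soon as d >= 2. *)
have sd : (d ^ 2 <= 4 * size s)%N by rewrite sE bin2; nia.
rewrite -[4]mulr1; apply: le_trans (_ : 4 * (pr (none eps d) * ((size s)%:R * p)) <= _); last first.
  by rewrite ler_pM2l.
rewrite [leRHS](_ : _ = pr (none eps d) * ((4 * size s)%N%:R * p)); last by rewrite natrM; ring.
by rewrite ler_wpM2l ?pr_ge0// ler_wpM2r// -natrX ler_nat.
Qed.

End recursion.

(** Positivity of [eps] keeps the default value 0 of the maximum from counting as an overlap;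
    symmetry reduces ordered pairs to i < j. *)
Lemma eta_max_ge (eps : R) : 0 < eps ->
  [set w | eps <= eta_max E w] = ~` none eps d.
Proof.
move=> eps0; apply/seteqP; split => w /=.
  move=> H /mem_none N; move: H; apply/negP; rewrite -ltNge.
  apply/bigmax_ltP; split => // -[i j] /= ij.
  rewrite ltNge; apply/negP => O.
  have [ltij|ltji|eqij] := ltngtP i j.
  - exact: N ltij (ltn_ord j) O.
  - by apply: N ltji (ltn_ord i) _; rewrite overlapC.
  - by rewrite (val_inj eqij) eqxx in ij.
move=> nN; have : ~ (eta_max E w < eps).
  move=> /bigmax_ltP[_ H]; apply: nN; apply/mem_none => i j ij _ O.
  have ne : i != j by apply: contraTneq ij => ->; rewrite ltnn.
  by have := H (i, j) ne; rewrite ltNge => /negP; apply.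
by move=> /negP; rewrite -leNgt.
Qed.

Lemma measurable_eta_max : measurable_fun setT (eta_max E).
Proof.
rewrite /eta_max; elim: (index_enum _) => [|a s IH].
  rewrite (_ : (fun _ => _) = cst 0); first exact: measurable_cst.
  by apply/funext => w; rewrite big_nil.
case: (boolP (a.1 != a.2)) => a12; last first.
  by under eq_fun do rewrite big_cons (negbTE a12).
under eq_fun do rewrite big_cons a12.
apply: measurable_maxr => //.
rewrite (_ : (fun _ => _) = @Num.sqrt R \o (fun w => sqmod (braket (E a.1 w) (E a.2 w)))).
  apply: measurableT_comp; last by apply: measurable_sqmod_braket; exact: measurable_E.
  by apply: continuous_measurable_fun; exact: sqrt_continuous.
by apply/funext => w /=; rewrite normcE.
Qed.

Lemma measurable_eta_max_ge r : measurable [set w | r <= eta_max E w].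
Proof.
rewrite (_ : [set _ | _] = eta_max E @^-1` `[r, +oo[%classic).
  exact: measurable_preimage measurable_eta_max _.
by apply/seteqP; split => w /=; rewrite in_itv /= andbT.
Qed.

(** The law places the vectors on the sphere only almost surely, so the Cauchy-Schwarz bound holds
    off a null set. *)
Lemma pr_eta_max_gt1 : pr [set w | 1 < eta_max E w] = 0.
Proof.
have mg : measurable [set w | 1 < eta_max E w].
  rewrite (_ : [set _ | _] = eta_max E @^-1` `]1, +oo[%classic).
    exact: measurable_preimage measurable_eta_max _.
  by apply/seteqP; split => w /=; rewrite in_itv /= andbT.
have mS i : measurable (~` (E i @^-1` @csphere R m.+1)).
  by apply: measurableC; apply: measurable_E_preimage; exact: measurable_csphere.
apply/eqP; rewrite eq_le pr_ge0 andbT.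
apply: (@le_trans _ _ (pr (\big[setU/set0]_(i : 'I_d) ~` (E i @^-1` @csphere R m.+1)))).
  apply: le_pr => //; first by apply: bigsetU_measurable => i _.
  move=> w /= w1; rewrite -bigcup_seq; apply: contrapT => N.
  have S i : sqnorm (E i w) = 1.
    rewrite -csphereE; apply: contrapT => Si; apply: N.
    by exists i => //=; rewrite mem_index_enum.
  move: w1; apply/negP; rewrite -leNgt; apply/bigmax_leP; split => // -[i j] _ /=.
  by rewrite normcE -sqrtr1 ler_wsqrtr// sqmod_braket_le1.
apply: le_trans (pr_bigsetU_le _ _ mS) _.
rewrite big1// => i _; rewrite pr_setC.
  by rewrite (pr_csphere E_unif) subrr.
by apply: measurable_E_preimage; exact: measurable_csphere.
Qed.

Lemma eta_max_ge0 w : 0 <= eta_max E w.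
Proof. by rewrite /eta_max; apply: bigmax_ge_id. Qed.

End eta.

(** * The birthday recursion *)

Section recursion_bounds.
Context (R : realType) (q : nat -> R) (p : R) (d : nat).
Hypotheses (p0 : 0 <= p) (q0 : q 0%N = 1).
Hypothesis q_ge0 : forall k, 0 <= q k.
Hypothesis q_le1 : forall k, q k <= 1.
Hypothesis q_lower : forall k, (k < d)%N -> q k * (1 - k%:R * p) <= q k.+1.
Hypothesis q_upper : forall k, (k < d)%N ->
  q k.+1 <= q k * (1 - k%:R * p) + k%:R ^+ 2 * p ^+ 2.

Lemma recursion_union_bound : 1 - d%:R ^+ 2 * p <= q d.
Proof.
suff H k : (k <= d)%N -> 1 - k%:R ^+ 2 * p <= q k by exact: H.
elim: k => [|k IH] kd; first by rewrite q0 expr0n mul0r subr0.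
apply: le_trans (q_lower kd); have := IH (ltnW kd).
have kp : 0 <= k%:R * p by rewrite mulr_ge0.
have : q k * (k%:R * p) <= k%:R * p by rewrite ler_piMl.
rewrite -[k.+1%:R]natr1 (_ : (k%:R + 1) ^+ 2 * p = k%:R ^+ 2 * p + 2 * (k%:R * p) + p); last by ring.
have aux (A B C Q : R) : 0 <= B -> C <= B -> 1 - A <= Q -> 1 - (A + 2 * B + p) <= Q - C.
  by move: p0 => p0' *; lra.
by move=> H1 H2; rewrite mulrBr mulr1; exact: aux.
Qed.

(** Invert 1 + y <= exp y at y = x / (1 - x), where 1 + y = 1 / (1 - x). *)
Lemma expR_ge_1B (x : R) : x < 1 -> expR (- (x / (1 - x))) <= 1 - x.
Proof.
move=> x1; have x1' : 0 < 1 - x by rewrite subr_gt0.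
rewrite expRN -[leRHS]invrK lef_pV2 ?posrE ?invr_gt0 ?expR_gt0//.
apply: le_trans (expR_ge1Dx _); rewrite le_eqVlt; apply/orP; left; apply/eqP.
by field; rewrite gt_eqF.
Qed.

(** Each factor 1 - k p is at least exp(- k p / (1 - d p)), and the sum of the k < d is at most d^2
    / 2. *)
Lemma recursion_exp_lower : d%:R * p < 1 ->
  expR (- (d%:R ^+ 2 / 2 * (p / (1 - d%:R * p)))) <= q d.
Proof.
move=> dp; set c := p / (1 - d%:R * p).
have dp' : 0 < 1 - d%:R * p by rewrite subr_gt0.
have c0 : 0 <= c by apply: divr_ge0 => //; exact: ltW.
suff H k : (k <= d)%N -> expR (- (k%:R ^+ 2 / 2 * c)) <= q k by exact: H.
elim: k => [|k IH] kd; first by rewrite q0 expr0n !mul0r oppr0 expR0.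
apply: le_trans (q_lower kd).
have kdp : k%:R * p <= d%:R * p by rewrite ler_wpM2r// ler_nat ltnW.
have k1 : k%:R * p < 1 by exact: le_lt_trans dp.
apply: (@le_trans _ _ (expR (- (k%:R ^+ 2 / 2 * c)) * expR (- (k%:R * p / (1 - k%:R * p))))).
  rewrite -expRD ler_expR -opprD lerN2.
  apply: (@le_trans _ _ (k%:R ^+ 2 / 2 * c + k%:R * c)).
    rewrite lerD2l /c -mulrA ler_wpM2l// ler_wpM2l//.
    by rewrite lef_pV2 ?posrE// ?subr_gt0// lerD2l lerN2.
  rewrite -[k.+1%:R]natr1 (_ : (k%:R + 1) ^+ 2 / 2 * c = k%:R ^+ 2 / 2 * c + k%:R * c + c / 2); last by field.
  by rewrite lerDl divr_ge0.
apply: ler_pM; rewrite ?expR_ge0//; first by apply: IH; exact: ltnW.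
exact: expR_ge_1B.
Qed.

(** The factors 1 - k p <= exp(- k p) multiply to the exponent p d (d - 1) / 2, and the errors k^2
    p^2 add up to at most d^3 p^2. *)
Lemma recursion_exp_upper :
  q d <= expR (- (p * (d%:R * (d%:R - 1)) / 2)) + d%:R ^+ 3 * p ^+ 2.
Proof.
suff H k : (k <= d)%N ->
    q k <= expR (- (p * (k%:R * (k%:R - 1)) / 2)) + k%:R ^+ 3 * p ^+ 2 by exact: H.
elim: k => [|k IH] kd.
  by rewrite q0 mul0r mulr0 mul0r oppr0 expR0 expr0n mul0r addr0.
apply: le_trans (q_upper kd) _; have {}IH := IH (ltnW kd).
have kp : 0 <= k%:R * p by rewrite mulr_ge0.
have e1 : 1 - k%:R * p <= expR (- (k%:R * p)) by exact: expR_ge1Dx.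
have e2 : expR (- (k%:R * p)) <= 1 by rewrite -[leRHS]expR0 ler_expR oppr_le0.
have H1 : q k * (1 - k%:R * p) <= q k * expR (- (k%:R * p)) by rewrite ler_wpM2l.
have H2 : q k * expR (- (k%:R * p)) <=
   (expR (- (p * (k%:R * (k%:R - 1)) / 2)) + k%:R ^+ 3 * p ^+ 2) * expR (- (k%:R * p)).
  by rewrite ler_wpM2r// expR_ge0.
have H3 : k%:R ^+ 3 * p ^+ 2 * expR (- (k%:R * p)) <= k%:R ^+ 3 * p ^+ 2.
  by rewrite ler_piMr// mulr_ge0// ?sqr_ge0// exprn_ge0.
rewrite mulrDl -expRD in H2.
have E : - (p * (k.+1%:R * (k.+1%:R - 1)) / 2) = - (p * (k%:R * (k%:R - 1)) / 2) - k%:R * p.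
  by rewrite -[k.+1%:R]natr1; field.
rewrite E.
have H4 : k%:R ^+ 3 * p ^+ 2 + k%:R ^+ 2 * p ^+ 2 <= k.+1%:R ^+ 3 * p ^+ 2.
  rewrite -mulrDl ler_wpM2r ?sqr_ge0// -[k.+1%:R]natr1.
  have k0 : 0 <= k%:R :> R by [].
  rewrite -subr_ge0 (_ : _ - _ = 2 * k%:R ^+ 2 + 3 * k%:R + 1); last by ring.
  by rewrite !addr_ge0// mulr_ge0// sqr_ge0.
by lra.
Qed.

End recursion_bounds.

Section threshold.
Context (R : realType).

(** Here x stands for the square root of p, and the critical d is c / x. The bound x0 is uniform in
    q, which changes with n; no monotonicity of q is assumed, so the first conclusion covers every d
    below the threshold. *)
Lemma birthday_threshold (c eta : R) : 0 < c -> 0 < eta < 1 ->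
  exists2 x0 : R, 0 < x0 & forall (x : R) (q : nat -> R), 0 < x < x0 ->
    (forall d, d%:R * x ^+ 2 < 1 ->
       expR (- (d%:R ^+ 2 / 2 * (x ^+ 2 / (1 - d%:R * x ^+ 2)))) <= q d) ->
    (forall d, q d <= expR (- (x ^+ 2 * (d%:R * (d%:R - 1)) / 2)) + d%:R ^+ 3 * (x ^+ 2) ^+ 2) ->
    (forall d, d%:R <= (1 - eta) * (c / x) -> expR (- (c ^+ 2 / 2)) < q d) /\
    (exists2 d, d%:R <= (1 + eta) * (c / x) & q d <= expR (- (c ^+ 2 / 2))).
Proof.
move=> c0 /andP[eta0 eta1].
pose gap := expR (- (c ^+ 2 / 2)) - expR (- ((1 + eta / 2) ^+ 2 * c ^+ 2 / 2)).
have gap0 : 0 < gap.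
  rewrite subr_gt0 ltr_expR ltrN2 ltr_pM2r ?invr_gt0// ltr_pMl ?exprn_gt0//.
  by rewrite exprn_egt1//; lra.
(* The three bounds give d x^2 < eta below the threshold, room eta c / (2 x) >= 2 for rounding, and
   an error d^3 x^4 <= (2 c)^3 x below [gap]. *)
pose x0 := Num.min (eta / c) (Num.min (eta * c / 4) (gap / (8 * c ^+ 3))).
have c3 : 0 < 8 * c ^+ 3 by rewrite mulr_gt0// exprn_gt0.
exists x0.
  by rewrite !lt_min !divr_gt0//= mulr_gt0.
move=> x q /andP[x_gt0]; rewrite !lt_min => /and3P[xA xB xC] L U; split=> [d dle|].
  have dx : d%:R * x <= (1 - eta) * c by rewrite -ler_pdivlMr// -mulrA.
  have dx0 : 0 <= d%:R * x by rewrite mulr_ge0// ltW.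
  have cx : c * x < eta by rewrite mulrC -ltr_pdivlMr.
  have cx0 : 0 < c * x by rewrite mulr_gt0.
  have dp : d%:R * x ^+ 2 <= c * x.
    rewrite expr2 mulrA ler_wpM2r ?(ltW x_gt0)//; apply: le_trans dx _.
    by rewrite ler_piMl ?(ltW c0)//; lra.
  have dp1 : d%:R * x ^+ 2 < 1 by lra.
  apply: lt_le_trans (L d dp1); rewrite ltr_expR ltrN2.
  have D0 : 0 < 1 - d%:R * x ^+ 2 by lra.
  rewrite (_ : d%:R ^+ 2 / 2 * _ = (d%:R * x) ^+ 2 / (1 - d%:R * x ^+ 2) / 2); last first.
    by field; rewrite gt_eqF.
  rewrite ltr_pM2r ?invr_gt0// ltr_pdivrMr//.
  apply: (@le_lt_trans _ _ (((1 - eta) * c) ^+ 2)).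
    by rewrite ler_sqr ?nnegrE// (le_trans dx0).
  rewrite exprMn mulrC ltr_pM2l ?exprn_gt0//.
  (* Together with d x^2 <= c x < eta, this puts (1 - eta)^2 below the denominator 1 - d x^2. *)
  have : (1 - eta) ^+ 2 <= 1 - eta by rewrite expr2 ler_piMl//; lra.
  by lra.
pose y := (1 + eta / 2) * (c / x).
have cx0 : 0 < c / x by rewrite divr_gt0.
have y0 : 0 <= y by rewrite mulr_ge0 ?(ltW cx0)//; lra.
have /andP[ty yt] := Num.Theory.truncn_itv y0.
have eta2 : 2 <= eta / 2 * (c / x).
  by rewrite mulrA ler_pdivlMr//; clear -xB; lra.
have dle' : (Num.truncn y).+2%:R <= (1 + eta) * (c / x).
  rewrite -addn2 natrD (_ : (1 + eta) * (c / x) = y + eta / 2 * (c / x)); first exact: lerD.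
  by rewrite /y; field; rewrite gt_eqF.
(* Rounding up by two makes d - 1 >= y, hence d (d - 1) >= y^2. *)
exists (Num.truncn y).+2 => //.
have d1 : y <= (Num.truncn y).+1%:R by exact: ltW.
set d := (Num.truncn y).+2.
have dE : d%:R = (Num.truncn y).+1%:R + 1 :> R by rewrite natr1.
have dle : d%:R * x <= 2 * c.
  rewrite -ler_pdivlMr// -mulrA; apply: le_trans dle' _.
  by rewrite ler_wpM2r ?(ltW cx0)//; lra.
apply: le_trans (U d) _.
have E1 : expR (- (x ^+ 2 * (d%:R * (d%:R - 1)) / 2)) <= expR (- ((1 + eta / 2) ^+ 2 * c ^+ 2 / 2)).
  rewrite ler_expR lerN2 ler_pM2r ?invr_gt0//.
  rewrite (_ : (1 + eta / 2) ^+ 2 * c ^+ 2 = x ^+ 2 * (y * y)); last first.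
    by rewrite /y; field; rewrite gt_eqF.
  rewrite ler_wpM2l ?sqr_ge0//; apply: ler_pM => //; rewrite dE ?addrK//.
  by apply: le_trans d1 _; rewrite lerDl.
have E2 : d%:R ^+ 3 * (x ^+ 2) ^+ 2 <= gap.
  rewrite (_ : _ * _ = (d%:R * x) ^+ 3 * x); last by ring.
  apply: (@le_trans _ _ ((2 * c) ^+ 3 * x)).
    rewrite ler_wpM2r ?(ltW x_gt0)// ler_pXn2r ?nnegrE//.
      by rewrite mulr_ge0// ltW.
    by rewrite mulr_ge0// ltW.
  rewrite (_ : (2 * c) ^+ 3 = 8 * c ^+ 3); last by ring.
  by rewrite mulrC -ler_pdivlMr// ltW.
by move: E1 E2; rewrite /gap; lra.
Qed.

End threshold.

(** * Tail bounds for the maximal overlap *)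

Section eta_tails.
Context (R : realType) (disp : measure_display) (Omega : measurableType disp).
Context (P : probability Omega R) (m d : nat).
Variable E : 'I_d -> {RV P >-> Cvec R m.+1}.
Hypothesis E_unif : forall i, uniform_on_csphere (E i).
Hypothesis E_indep : mutually_independent E.
Local Notation pr := (pr P).

Lemma pr_eta_max_ge (eps : R) : 0 < eps ->
  pr [set w | eps <= eta_max E w] = 1 - pr (none E eps d).
Proof. by move=> eps0; rewrite eta_max_ge// pr_setC//; exact: measurable_none. Qed.

Lemma overlap_prob_ge0 (eps : R) : 0 <= eps -> eps < 1 -> 0 <= (1 - eps ^+ 2) ^+ m.
Proof. by move=> e0 e1; rewrite exprn_ge0// subr_ge0 exprn_ile1// ltW. Qed.

Lemma none_union_bound (eps : R) : 0 <= eps -> eps < 1 ->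
  1 - d%:R ^+ 2 * (1 - eps ^+ 2) ^+ m <= pr (none E eps d).
Proof.
move=> e0 e1; apply: (@recursion_union_bound R (fun k => pr (none E eps k)) _ d).
- exact: overlap_prob_ge0.
- by rewrite none0 prT.
- by move=> k; apply: pr_le1; exact: measurable_none.
- by move=> k kd; exact: (pr_none_ge E_unif E_indep e0 e1 (Ordinal kd)).
Qed.

Lemma none_exp_lower (eps : R) : 0 <= eps -> eps < 1 ->
  d%:R * (1 - eps ^+ 2) ^+ m < 1 ->
  expR (- (d%:R ^+ 2 / 2 * ((1 - eps ^+ 2) ^+ m / (1 - d%:R * (1 - eps ^+ 2) ^+ m))))
    <= pr (none E eps d).
Proof.
move=> e0 e1; apply: (@recursion_exp_lower R (fun k => pr (none E eps k)) _ d).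
- exact: overlap_prob_ge0.
- by rewrite none0 prT.
- by move=> k kd; exact: (pr_none_ge E_unif E_indep e0 e1 (Ordinal kd)).
Qed.

Lemma none_exp_upper (eps : R) : 0 <= eps -> eps < 1 ->
  pr (none E eps d) <=
  expR (- ((1 - eps ^+ 2) ^+ m * (d%:R * (d%:R - 1)) / 2))
    + d%:R ^+ 3 * ((1 - eps ^+ 2) ^+ m) ^+ 2.
Proof.
move=> e0 e1; apply: (@recursion_exp_upper R (fun k => pr (none E eps k)) _ d).
- exact: overlap_prob_ge0.
- by rewrite none0 prT.
- by move=> k; exact: pr_ge0.
- by move=> k kd; exact: (pr_none_le E_unif E_indep e0 e1 (Ordinal kd)).
Qed.

Lemma measurable_eta_max_near (t delta : R) :
  measurable [set w | `|eta_max E w - t| <= delta].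
Proof.
rewrite (_ : [set _ | _] = eta_max E @^-1` `[t - delta, t + delta]%classic).
  exact: measurable_preimage (measurable_eta_max E) _.
by apply/seteqP; split => w /=; rewrite in_itv /= ler_distl.
Qed.

Variables (a delta : R).
Hypotheses (d2 : (2 <= d)%N) (a0 : 0 < a) (a1 : a <= 1).
Hypotheses (delta0 : 0 < delta) (delta1 : delta < 1).
Hypothesis ad : d%:R ^+ 2 * a ^+ m.+1 = 1.
Local Notation t := (Num.sqrt (1 - a)).

(** With [b] = 1 - eps^2 the left side is d^2 p, the order of the expected number of overlaps. This
    form exhibits b = a as the critical point. *)
Lemma dsqE (b : R) : d%:R ^+ 2 * b ^+ m = a^-1 * (b / a) ^+ m.
Proof.
have an : a != 0 by rewrite gt_eqF.
have -> : d%:R ^+ 2 = (a ^+ m.+1)^-1.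
  by apply: (mulIf (expf_neq0 m.+1 an)); rewrite ad mulVf// expf_neq0.
by rewrite expr_div_n exprS; field; rewrite expf_neq0 ?an.
Qed.

(** Since (t + delta)^2 >= 1 - a + delta^2, the tail is null when a <= delta^2. Otherwise b = 1 - (t
    + delta)^2 satisfies b / a <= 1 - delta^2, and a^-1 <= delta^-2 in the union bound. *)
Lemma upper_tail : pr [set w | t + delta < eta_max E w] <=
  (if a <= delta ^+ 2 then 0 else delta ^- 2 * (1 - delta ^+ 2) ^+ m).
Proof.
have t0 : 0 <= t by exact: sqrtr_ge0.
have t2 : t ^+ 2 = 1 - a by rewrite sqr_sqrtr// subr_ge0.
have [[a0' a1'] [delta0' delta1']] := ((a0, a1), (delta0, delta1)).
have mgt r : measurable [set w | r < eta_max E w].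
  rewrite (_ : [set _ | _] = eta_max E @^-1` `]r, +oo[%classic).
    exact: measurable_preimage (measurable_eta_max E) _.
  by apply/seteqP; split => w /=; rewrite in_itv /= andbT.
have dd : 0 < delta ^+ 2 by rewrite exprn_gt0.
have rhs0 : 0 <= delta ^- 2 * (1 - delta ^+ 2) ^+ m.
  rewrite mulr_ge0 ?invr_ge0 ?(ltW dd)// exprn_ge0// subr_ge0.
  by rewrite exprn_ile1 // ltW.
have [td|td] := leP 1 (t + delta).
  apply: (@le_trans _ _ 0); last by case: ifP.
  rewrite -(pr_eta_max_gt1 E_unif); apply: le_pr => //.
  by move=> w; exact: le_lt_trans.
have sq : t ^+ 2 + delta ^+ 2 <= (t + delta) ^+ 2.
  by rewrite sqrrD -addrA addrCA lerDr mulrn_wge0// mulr_ge0// ltW.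
have lt1 : (t + delta) ^+ 2 < 1 by rewrite exprn_ilt1// addr_ge0// ltW.
have adl : delta ^+ 2 < a by move: sq lt1; rewrite t2; lra.
rewrite ifN -?ltNge//.
have td0 : 0 < t + delta by rewrite ltr_wpDl.
apply: (@le_trans _ _ (pr [set w | t + delta <= eta_max E w])).
  apply: le_pr => //; first exact: measurable_eta_max_ge.
  by move=> w; exact: ltW.
rewrite pr_eta_max_ge//.
have := none_union_bound (ltW td0) td; rewrite dsqE => H.
apply: (@le_trans _ _ (a^-1 * ((1 - (t + delta) ^+ 2) / a) ^+ m)); first by move: H; lra.
have b0 : 0 <= (1 - (t + delta) ^+ 2) / a by rewrite divr_ge0// ?ltW// subr_gt0.
apply: ler_pM => //.
- by rewrite invr_ge0 ltW.
- exact: exprn_ge0.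
- by rewrite lef_pV2 ?posrE//; exact: ltW.
- apply: lerXn2r; rewrite ?nnegrE//.
    by rewrite subr_ge0 (le_trans (ltW adl)).
  rewrite ler_pdivrMr//; apply: (@le_trans _ _ (a - delta ^+ 2)).
    by move: sq; rewrite t2; lra.
  by rewrite mulrBl mul1r lerD2l lerN2 ler_piMr// ltW.
Qed.

(** Here b = 1 - (t - delta)^2 >= a + delta^2 >= (1 + delta^2) a, which enters the second-moment
    bound. The remaining factor [a] gives smallness when d grows while n stays bounded. *)
Lemma lower_tail : pr [set w | eta_max E w < t - delta] <=
  4 * a / (1 + delta ^+ 2) ^+ m.
Proof.
have t0 : 0 <= t by exact: sqrtr_ge0.
have t2 : t ^+ 2 = 1 - a by rewrite sqr_sqrtr// subr_ge0.
have [[a0' a1'] [delta0' delta1']] := ((a0, a1), (delta0, delta1)).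
have dd : 0 < delta ^+ 2 by rewrite exprn_gt0.
have D0 : 0 < (1 + delta ^+ 2) ^+ m by rewrite exprn_gt0// ltr_wpDl.
have rhs0 : 0 <= 4 * a / (1 + delta ^+ 2) ^+ m.
  by rewrite divr_ge0 ?(ltW D0)// mulr_ge0// ltW.
have [td|td] := leP (t - delta) 0.
  rewrite (_ : [set _ | _] = set0) ?pr0//; apply/seteqP; split => w //= H.
  by have := le_lt_trans (eta_max_ge0 E w) (lt_le_trans H td); rewrite ltxx.
have t1 : t <= 1 by rewrite -[leRHS]sqrtr1 ler_wsqrtr// gerBl ltW.
have td1 : t - delta < 1 by lra.
rewrite (_ : [set _ | _] = ~` [set w | t - delta <= eta_max E w]); last first.
  by apply/seteqP; split => w /=; [move=> H; apply/negP; rewrite -ltNge|move=> /negP; rewrite -ltNge].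
rewrite pr_setC; last exact: measurable_eta_max_ge.
rewrite pr_eta_max_ge// opprB addrCA subrr addr0.
have := pr_none_second_moment E_unif E_indep (ltW td) td1 d2; rewrite dsqE => H.
rewrite ler_pdivlMr// -ler_pdivrMr//.
apply: le_trans H; rewrite -mulrA ler_wpM2l ?pr_ge0//.
rewrite mulrC ler_wpM2l ?invr_ge0 ?(ltW a0)//.
apply: lerXn2r; rewrite ?nnegrE//.
- by rewrite addr_ge0// ltW.
- rewrite divr_ge0 ?(ltW a0)// subr_ge0 exprn_ile1//; exact: ltW.
rewrite ler_pdivlMr//.
have : (t - delta) ^+ 2 + delta ^+ 2 <= t ^+ 2.
  rewrite -subr_ge0 (_ : _ - _ = 2 * (delta * (t - delta))); last by ring.
  by rewrite mulr_ge0// mulr_ge0// ltW.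
have : (1 + delta ^+ 2) * a <= a + delta ^+ 2.
  by rewrite mulrDl mul1r lerD2l ler_piMr// ltW.
by rewrite t2; lra.
Qed.

Lemma eta_max_concentration :
  1 - pr [set w | `|eta_max E w - t| <= delta] <=
  (if a <= delta ^+ 2 then 0 else delta ^- 2 * (1 - delta ^+ 2) ^+ m)
    + 4 * a / (1 + delta ^+ 2) ^+ m.
Proof.
have mS := measurable_eta_max_near t delta.
rewrite -pr_setC//; apply: le_trans (lerD upper_tail lower_tail).
have m1 : measurable [set w | t + delta < eta_max E w].
  rewrite (_ : [set _ | _] = eta_max E @^-1` `]t + delta, +oo[%classic).
    exact: measurable_preimage (measurable_eta_max E) _.
  by apply/seteqP; split => w /=; rewrite in_itv /= andbT.
have m2 : measurable [set w | eta_max E w < t - delta].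
  rewrite (_ : [set _ | _] = eta_max E @^-1` `]-oo, t - delta[%classic).
    exact: measurable_preimage (measurable_eta_max E) _.
  by apply/seteqP; split => w /=; rewrite in_itv /=.
apply: le_trans (pr_setU_le _ m1 m2).
apply: le_pr; [exact: measurableC|exact: measurableU|].
move=> w /= /negP; rewrite ler_distl negb_and -!ltNge => /orP[H|H]; [by right|by left].
Qed.

End eta_tails.

(** * The theorem *)

Lemma geometric_small (R : realType) (z eps : R) : 0 <= z -> z < 1 -> 0 < eps ->
  exists N : nat, forall n, (N <= n)%N -> z ^+ n < eps.
Proof.
move=> z0 z1 eps0.
have /cvgrPdist_lt/(_ _ eps0)[N _ H] : (fun n => z ^+ n) @ \oo --> (0 : R).
  by apply: cvg_expr; rewrite ger0_norm.
exists N => n Nn; have := H n Nn.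
by rewrite sub0r normrN ger0_norm// exprn_ge0.
Qed.

Lemma min_natP (S : set nat) : S !=set0 ->
  S (min_nat S) /\ forall k, S k -> (min_nat S <= k)%N.
Proof.
move=> S0; rewrite /min_nat.
have ex : exists k, `[< S k >] by case: S0 => k Sk; exists k; exact/asboolP.
case: (ex_minnP ex) => k /asboolP Sk mink.
have H : [set m | S m /\ forall j, S j -> (m <= j)%N] k.
  by split => // j Sj; apply: mink; exact/asboolP.
have [Sx minx] := xgetI 0%N H.
by split.
Qed.

Lemma inverse_power (R : realType) (d m : nat) : (1 <= d)%N ->
  let a := d%:R `^ (- 2 / m.+1%:R) : R in
  [/\ 0 < a, a <= 1 & d%:R ^+ 2 * a ^+ m.+1 = 1].
Proof.
move=> d1 a.
have d0 : 0 < d%:R :> R by rewrite ltr0n.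
have a0 : 0 < a by exact: powR_gt0.
have ad : d%:R ^+ 2 * a ^+ m.+1 = 1.
  rewrite -[a ^+ _]powR_mulrn ?(ltW a0)// /a -powRrM divfK ?pnatr_eq0//.
  by rewrite powRN powR_mulrn ?ler0n// divff// expf_neq0// gt_eqF.
split => //; rewrite leNgt; apply/negP => a1.
have : 1 < d%:R ^+ 2 * a ^+ m.+1.
  apply: (@lt_le_trans _ _ (a ^+ m.+1)); first by rewrite exprn_egt1.
  by rewrite ler_peMl ?exprn_ge0 ?(ltW a0)// exprn_ege1// ler1n.
by rewrite ad ltxx.
Qed.

(** For m + 1 >= [M0] both powers are small whatever d is. Otherwise d is large and a <= [theta],
    which makes the first term zero and the second at most 4 a. *)
Lemma concentration_rate (R : realType) (delta kappa : R) :
  0 < delta -> delta < 1 -> 0 < kappa ->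
  exists N : nat, forall m d : nat, (1 <= d)%N -> (N <= maxn m.+1 d)%N ->
    let a := d%:R `^ (- 2 / m.+1%:R) : R in
    (if a <= delta ^+ 2 then 0 else delta ^- 2 * (1 - delta ^+ 2) ^+ m)
      + 4 * a / (1 + delta ^+ 2) ^+ m < kappa.
Proof.
move=> delta0 delta1 kappa0.
have dd : 0 < delta ^+ 2 by rewrite exprn_gt0.
have dd1 : delta ^+ 2 < 1 by rewrite exprn_ilt1// ltW.
have z0 : 0 <= 1 - delta ^+ 2 by lra.
have z1 : 1 - delta ^+ 2 < 1 by lra.
have e1 : 0 < delta ^+ 2 * (kappa / 3) by rewrite mulr_gt0// divr_gt0.
have [N1 H1] := geometric_small z0 z1 e1.
have iv : 0 < (1 + delta ^+ 2)^-1 by rewrite invr_gt0; lra.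
have iv1 : (1 + delta ^+ 2)^-1 < 1 by rewrite invf_lt1; lra.
have e2 : 0 < kappa / 12 by rewrite divr_gt0.
have [N2 H2] := geometric_small (ltW iv) iv1 e2.
(* The first bound triggers the zero branch; the second gives 4 a < kappa. *)
pose theta := Num.min (delta ^+ 2) (kappa / 5).
have theta0 : 0 < theta by rewrite lt_min dd divr_gt0.
have theta1 : theta < 1 by rewrite gt_min dd1.
pose M0 := (maxn N1 N2).+1.
(* If d >= [N3] and m + 1 < [M0], then a > theta would force d^2 a^(m+1) > d theta^M0 > 1,
   contradicting d^2 a^(m+1) = 1. *)
have [N3 N3P] : exists N3 : nat, theta ^- M0 < N3%:R.
  have th : 0 <= theta ^- M0 by rewrite invr_ge0 exprn_ge0// ltW.
  by exists (Num.truncn (theta ^- M0)).+1; have /andP[] := Num.Theory.truncn_itv th.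
exists (maxn M0 N3) => m d d1 HN; rewrite leq_max !geq_max in HN.
cbv zeta; set a := d%:R `^ _.
have [a0 a1 ad] := @inverse_power R d m d1; rewrite -/a in a0 a1 ad.
have D1 : 0 <= (1 + delta ^+ 2) ^- m <= 1.
  rewrite -exprVn exprn_ge0 ?(ltW iv)//=; apply: exprn_ile1; exact: ltW.
have [mM|mM] := leqP M0 m.+1.
  have m1 : (N1 <= m)%N := leq_trans (leq_maxl N1 N2) mM.
  have m2 : (N2 <= m)%N := leq_trans (leq_maxr N1 N2) mM.
  have T1 : (if a <= delta ^+ 2 then 0 else delta ^- 2 * (1 - delta ^+ 2) ^+ m) <= kappa / 3.
    case: ifP => _; first by rewrite divr_ge0// ltW.
    by rewrite mulrC ler_pdivrMr// mulrC ltW// H1.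
  have T2 : 4 * a / (1 + delta ^+ 2) ^+ m <= kappa / 3.
    rewrite -mulrA; apply: (@le_trans _ _ (4 * (kappa / 12))); last by lra.
    rewrite ler_wpM2l//; apply: (@le_trans _ _ (1 * (1 + delta ^+ 2) ^- m)).
      by rewrite ler_wpM2r//; case/andP: D1.
    by rewrite mul1r -exprVn ltW// H2.
  by apply: le_lt_trans (lerD T1 T2) _; lra.
have {}HN : (N3 <= d)%N.
  case/orP: HN => /andP[H H'] //.
  by have := leq_ltn_trans H mM; rewrite ltnn.
have ath : a <= theta.
  rewrite leNgt; apply/negP => ath.
  have : 1 < d%:R ^+ 2 * a ^+ m.+1.
    apply: (@lt_trans _ _ (d%:R * theta ^+ M0)).
      rewrite -ltr_pdivrMr ?exprn_gt0// mul1r.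
      by apply: lt_le_trans N3P _; rewrite ler_nat.
    apply: (@le_lt_trans _ _ (d%:R * theta ^+ m.+1)).
      by rewrite ler_wpM2l// ler_wiXn2l// ?(ltW theta0) ?(ltW theta1)// ltnW.
    rewrite expr2 -mulrA; apply: (@lt_le_trans _ _ (d%:R * a ^+ m.+1)).
      by rewrite ltr_pM2l ?ltr0n// ltrXn2r// ltW.
    by rewrite ler_wpM2l// ler_peMl ?exprn_ge0 ?(ltW a0)// ler1n.
  by rewrite ad ltxx.
have [ath1 ath2] : a <= delta ^+ 2 /\ a <= kappa / 5 by move: ath; rewrite le_min => /andP.
rewrite ath1 add0r; apply: (@le_lt_trans _ _ (4 * a)); last by lra.
by case/andP: D1 => _ D1; rewrite ler_piMr// mulr_ge0// ltW.
Qed.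

Section d_max_bracket.
Context (R : realType) (disp : nat -> measure_display)
  (Omega : forall d : nat, measurableType (disp d))
  (P : forall d : nat, probability (Omega d) R) (m : nat)
  (E : forall d : nat, 'I_d -> {RV (P d) >-> Cvec R m.+1}).
Hypothesis E_unif : forall (d : nat) (i : 'I_d), uniform_on_csphere (@E d i).
Hypothesis E_indep : forall d : nat, mutually_independent (@E d).
Variables (eps s c : R).
Hypotheses (eps0 : 0 < eps) (eps1 : eps < 1).
Hypothesis sE : 1 - s = expR (- (c ^+ 2 / 2)).

Let q d : R := pr (P d) (none (@E d) eps d).

Lemma d_max_setE (d : nat) :
  (s%:E <= P d [set w | (eps <= eta_max (@E d) w)%R])%E = (q d <= expR (- (c ^+ 2 / 2))).
Proof.
rewrite prE; last exact: measurable_eta_max_ge.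
by rewrite lee_fin pr_eta_max_ge// -sE /q; apply/idP/idP; lra.
Qed.

(** The second assumption also shows that the minimum is over a nonempty set, so the default value
    of [min_nat] does not arise. *)
Lemma d_max_bracket (y z : R) :
  (forall d, d%:R <= y -> expR (- (c ^+ 2 / 2)) < q d) ->
  (exists2 d, d%:R <= z & q d <= expR (- (c ^+ 2 / 2))) ->
  y < (d_max E eps s)%:R <= z.
Proof.
move=> Hy [d dz qd]; rewrite /d_max.
have [|Sm mS] := @min_natP [set d | (s%:E <= P d [set w | (eps <= eta_max (@E d) w)%R])%E].
  by exists d; rewrite /= d_max_setE.
rewrite /= d_max_setE in Sm.
apply/andP; split; last first.
  by apply: le_trans dz; rewrite ler_nat; apply: mS; rewrite /= d_max_setE.
by rewrite ltNge; apply/negP => /Hy; rewrite ltNge Sm.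
Qed.

End d_max_bracket.

(** Identifies the inverse of the growth factor with the square root of p, the x of
    [birthday_threshold]. *)
Lemma sqr_inv_powR (R : realType) (r : R) (m : nat) : 0 < r ->
  ((1 / r) `^ ((m.+1%:R - 1) / 2))^-1 ^+ 2 = r ^+ m.
Proof.
move=> r0; have rv : 0 < 1 / r by rewrite divr_gt0.
rewrite exprVn -[X in X^-1 = _]powR_mulrn ?powR_ge0// -powRrM divfK ?pnatr_eq0//.
rewrite -natr1 addrK powR_mulrn ?(ltW rv)// div1r exprVn invrK//.
Qed.

Theorem theorem2p5 (R : realType)
  (disp : nat -> nat -> measure_display)
  (Omega : forall n d : nat, measurableType (disp n d))
  (P : forall n d : nat, probability (Omega n d) R)
  (E : forall n d : nat, 'I_d -> {RV (P n d) >-> Cvec R n})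
  (E_unif : forall (n d : nat) (i : 'I_d), (1 <= n)%N ->
     uniform_on_csphere (E n d i))
  (E_indep : forall n d : nat, (1 <= n)%N -> mutually_independent (E n d)) :
  (forall eps s : R, 0 < eps < 1 -> 0 <= s < 1 ->
     (fun n : nat => (d_max (E n) eps s)%:R : R^o) ~_\oo
     (fun n : nat => Num.sqrt (- 2 * ln (1 - s)) *
                     (1 / (1 - eps ^+ 2)) `^ ((n%:R - 1) / 2) : R^o))
  /\
  (forall delta : R, 0 < delta ->
     forall kappa : R, 0 < kappa ->
     exists N : nat, forall n d : nat, (1 <= n)%N -> (2 <= d)%N ->
       (N <= maxn n d)%N ->
       (`| P n d [set w |
             (`|eta_max (E n d) w - Num.sqrt (1 - d%:R `^ (- 2 / n%:R))|
                <= delta)%R] - 1 |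
          < kappa%:E)%E).
Proof.
split.
  move=> eps s /andP[eps0 eps1] /andP[s0 s1].
  have r0 : 0 < 1 - eps ^+ 2 by rewrite subr_gt0 exprn_ilt1// ltW.
  have r1 : 1 - eps ^+ 2 < 1 by rewrite gtrBl exprn_gt0.
  apply/eqaddoP => _/posnumP[eta].
  (* For s = 0 the constant c vanishes and d = 0 already qualifies, so both sequences are
     identically zero. *)
  have [s00|sn0] := eqVneq s 0.
    exists 0%N => // n _ /=; rewrite s00 subr0 ln1 mulr0 sqrtr0 mul0r.
    have [|_ /(_ 0%N)] := @min_natP [set d | (0%:E <= P n d [set w | (eps <= eta_max (E n d) w)%R])%E].
      by exists 0%N; rewrite /= measure_ge0.
    rewrite /= leqn0 measure_ge0 => /(_ isT)/eqP H.
    rewrite !fctE; have -> : d_max (E n) eps 0 = 0%N by exact: H.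
    by rewrite mul0r subr0 normr0 mulr0.
  have sp : 0 < s by rewrite lt0r sn0 s0.
  set c := Num.sqrt _.
  have ln0 : 0 < - 2 * ln (1 - s).
    by rewrite mulNr -mulrN mulr_gt0// oppr_gt0 ln_lt0//; lra.
  have c0 : 0 < c by rewrite sqrtr_gt0.
  have sE : 1 - s = expR (- (c ^+ 2 / 2)).
    rewrite sqr_sqrtr ?(ltW ln0)// [X in expR X](_ : _ = ln (1 - s)); last by field.
    by rewrite lnK// posrE; lra.
  (* The threshold lemma asks for a relative error below 1; a smaller error is a stronger
     conclusion. *)
  pose eta' := Num.min eta%:num (1 / 2).
  have eta'01 : 0 < eta' < 1.
    apply/andP; split; first by rewrite lt_min divr_gt0// andbT.
    by rewrite gt_min; apply/orP; right; lra.
  have [x0 x0_gt0 X] := birthday_threshold c0 eta'01.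
  have [N HN] := geometric_small (ltW r0) r1 (exprn_gt0 2 x0_gt0).
  exists N.+1 => // -[//|m]; rewrite /= ltnS => Nm; rewrite !fctE.
  set pw := _ `^ _; pose x := pw^-1.
  have pw0 : 0 < pw by apply: powR_gt0; rewrite divr_gt0.
  have x_gt0 : 0 < x by rewrite invr_gt0.
  have x2 : x ^+ 2 = (1 - eps ^+ 2) ^+ m by exact: sqr_inv_powR.
  have xx0 : x < x0 by rewrite -(@ltr_pXn2r _ 2)// ?nnegrE ?ltW// x2 HN.
  have Eu d i := E_unif m.+1 d i isT; have Ei d := E_indep m.+1 d isT.
  have [|||lo hi] := X x (fun d => pr (P m.+1 d) (none (E m.+1 d) eps d)).
  - by rewrite x_gt0 xx0.
  - by move=> d dx; rewrite x2; apply: none_exp_lower => //; rewrite ?ltW// -x2.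
  - by move=> d; rewrite x2; apply: none_exp_upper => //; rewrite ltW.
  have /andP[H1 H2] := d_max_bracket eps0 sE lo hi.
  have cx : c / x = c * pw by rewrite /x invrK.
  rewrite cx in H1 H2.
  have cp : 0 < c * pw by rewrite mulr_gt0.
  rewrite (gtr0_norm cp); apply: (@le_trans _ _ (eta' * (c * pw))); last first.
    by rewrite ler_wpM2r ?(ltW cp)// ge_min lexx.
  by rewrite ler_norml; move: H1 H2; rewrite !mulrDl !mul1r mulNr; lra.
move=> delta delta0 kappa kappa0.
(* The tail bounds require a radius below 1, and concentration within the smaller radius implies it
   within delta. *)
pose delta' := Num.min delta (1 / 2).
have d'0 : 0 < delta' by rewrite lt_min delta0 divr_gt0.
have d'1 : delta' < 1 by rewrite gt_min; apply/orP; right; lra.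
have [N HN] := concentration_rate d'0 d'1 kappa0.
exists N => -[//|m] d _ d2 Nmd.
have d1 : (1 <= d)%N by exact: ltnW.
have [a0 a1 ad] := @inverse_power R d m d1.
have := HN m d d1 Nmd; cbv zeta; set a := d%:R `^ _ in a0 a1 ad *.
have Eu i := E_unif m.+1 d i isT; have Ei := E_indep m.+1 d isT.
have := eta_max_concentration Eu Ei d2 a0 a1 d'0 d'1 ad.
set B := _ + _ => H1 H2.
have mS := measurable_eta_max_near (E m.+1 d) (Num.sqrt (1 - a)) delta.
rewrite prE// -EFinB abse_EFin lte_fin ler0_norm ?opprB; last by rewrite subr_le0 pr_le1.
apply: le_lt_trans H2; apply: le_trans H1; rewrite lerD2l lerN2.
apply: le_pr => //; first exact: measurable_eta_max_near.
by move=> w /= H; apply: le_trans H _; rewrite ge_min lexx.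
Qed.
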